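(* Let the sign $\pm$ be fixed, let $\alpha\in\overline{\mathbb{C}_\pm}$ and $z\in\mathbb{C}_\mp$. Then $$\big\|(\mathcal{W}_\alpha-z)^{-1}-(\mathcal{W}_{\alpha,n}-z)^{-1}\big\|_{\mathcal{L}(\mathscr{H})}\longrightarrow 0\qquad\text{as } n\to+\infty .$$
   Context: Fix $N\in\mathbb{N}^*=\{1,2,\dots\}$, put $\mathcal{N}=\{1,\dots,N\}$ and $\mathbb{R}_+^*=]0,+\infty[$. The star graph $\Gamma$ consists of $N$ copies of $\mathbb{R}_+^*$ joined at a central vertex $0$. A function $u$ on $\Gamma$ is a tuple $u=(u_j)_{j\in\mathcal{N}}$ of functions on $\mathbb{R}_+^*$; derivatives are taken componentwise. Put $L^2(\Gamma)=L^2(\mathbb{R}_+^* )^N$ (complex-valued functions, natural Hilbert structure) and, for $k\in\mathbb{N}^*$, $H^k(\Gamma^* )=H^k(\mathbb{R}_+^* )^N$, $\dot H^k(\Gamma^* )=\dot H^k(\mathbb{R}_+^* )^N$, where $\dot H^k(\mathbb{R}_+^* )$ is the space of locally integrable functions whose $k$-th distributional derivative is in $L^2(\mathbb{R}_+^* )$. A function $u\in\dot H^1(\Gamma^* )$ is continuous at $0$ if $u_j(0)=u_k(0)$ for all $j,k\in\mathcal{N}$; the common value is $u(0)$. Put $\dot H^1(\Gamma)=\{u\in\dot H^1(\Gamma^* ): u \text{ continuous at } 0\}$, $H^1(\Gamma)=\{u\in H^1(\Gamma^* ): u \text{ continuous at } 0\}$, and let $\tilde H^1(\Gamma)$ be the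 quotient of $\dot H^1(\Gamma)$ by constant functions, a Hilbert space for $\langle u,v\rangle_{\tilde H^1(\Gamma)}=\langle u',v'\rangle_{L^2(\Gamma)}$. Functions in $\dot H^1(\Gamma)$ are identified with their classes in $\tilde H^1(\Gamma)$. Let $\mathscr{H}=\tilde H^1(\Gamma)\times L^2(\Gamma)$, and $\mathcal{L}(\mathscr{H})$ the bounded operators on $\mathscr{H}$. Put $\mathbb{C}_\pm=\{z\in\mathbb{C}:\pm\mathrm{Re}(z)>0\}$. For $\alpha\in\mathbb{C}$, $\mathcal{W}_\alpha$ is the unbounded operator in $\mathscr{H}$ with domain $$\mathrm{Dom}(\mathcal{W}_\alpha)=\Big\{(u,v)\in\big(\tilde H^1(\Gamma)\cap\dot H^2(\Gamma^* )\big)\times H^1(\Gamma):\ \sum_{j=1}^N u_j'(0)+\alpha v(0)=0\Big\}$$ and action $\mathcal{W}_\alpha(u,v)=(v,u'')$. For $j\in\mathcal{N}$ let $\rho_j\in L^1(\mathbb{R}_+^* )$ be nonnegative with $\int_0^{+\infty}\sqrt{x}\,\rho_j(x)\,dx<+\infty$, and assume $\sum_{j=1}^N\int_0^{+\infty}\rho_j(x)\,dx=1$. For $n\in\mathbb{N}^*$ set $\rho_j^n(x)=n\rho_j(nx)$ and $\rho^n=(\rho_j^n)_{1\le j\le N}$, with $\rho^n v=(\rho_j^n v_j)_j$. The operator $\mathcal{W}_{\alpha,n}$ in $\mathscr{H}$ is $$\mathcal{W}_{\alpha,n}=\begin{pmatrix}0&1\\ \partial^2&\alpha\rho^n\end{pmatrix},\qquad\text{i.e.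 } \mathcal{W}_{\alpha,n}(u,v)=(v,\,u''+\alpha\rho^n v),$$ defined on the domain $$\mathrm{Dom}(\mathcal{W}_{\alpha,n})=\Big\{(u,v)\in\big(\tilde H^1(\Gamma)\cap\dot H^2(\Gamma^* )\big)\times H^1(\Gamma):\ \sum_{j=1}^N u_j'(0)=0\Big\}.$$ The paper establishes separately that, for $\alpha\in\overline{\mathbb{C}_\pm}$ and $z\in\mathbb{C}_\mp$, the number $z$ belongs to the resolvent sets of $\mathcal{W}_\alpha$ and of all $\mathcal{W}_{\alpha,n}$.
   Formalization: That z lies in the resolvent sets of W_α and of all W_{α,n} is taken as a hypothesis; with the stated domain (u in Ḣ²) it can fail when ρ is in L¹ but not in L², since αρⁿv need not be in L², and the resolvents are then undefined. *)

(* Defs.v *)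
From HB Require Import structures.
From mathcomp Require Import all_boot all_order all_algebra ring.
From mathcomp Require Import generic_quotient.
From mathcomp Require Import ring_quotient.
From mathcomp Require Import all_classical all_reals all_analysis.
From mathcomp Require Import measurable_realfun complex.
Import Order.TTheory GRing.Theory Num.Theory.
Import numFieldNormedType.Exports.
Import ComplexField.Normc.

Set Implicit Arguments.
Unset Strict Implicit.
Unset Printing Implicit Defensive.

Local Open Scope classical_set_scope.
Local Open Scope ring_scope.
Local Open Scope complex_scope.

Section LinearQuotient.
Local Open Scope quotient_scope.
Variables (K : pzRingType) (V : lmodType K) (S : submodClosed V).

Definition submod_zmod : V -> bool := fun x => x \in S.

Let submod_zmod_closed : zmod_closed submod_zmod.
Proof. exact: GRing.submod_closedB (GRing.submodClosedP S). Qed.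

HB.instance Definition _ := GRing.isZmodClosed.Build V submod_zmod submod_zmod_closed.

(* The library quotient is only a zmodType; scaling is added below. *)
Definition lquot := ring_quotient.Quotient.quot
  (GRing.ZmodClosed.clone V submod_zmod _).

HB.instance Definition _ := Choice.on lquot.
HB.instance Definition _ := GRing.Zmodule.on lquot.
HB.instance Definition _ := ring_quotient.ZmodQuotient.on lquot.

Definition lquot_scale (a : K) : lquot -> lquot :=
  fun x => \pi_lquot (a *: repr x).

Lemma pi_lquot_scale a (x : V) :
  \pi_lquot (a *: x) = lquot_scale a (\pi_lquot x).
Proof.
rewrite /lquot_scale; apply/eqP.
rewrite -ring_quotient.Quotient.idealrBE -scalerBr.
apply: (GRing.subsemimod_closedZ (GRing.subsemimodClosedP S)).
have : x - repr (\pi_lquot x) \in submod_zmod.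
  by rewrite ring_quotient.Quotient.idealrBE reprK.
by [].
Qed.

Let pi_D (x y : V) : \pi_lquot (x + y) = \pi_lquot x + \pi_lquot y.
Proof. exact: raddfD. Qed.

Let scaleA a b v : lquot_scale a (lquot_scale b v) = lquot_scale (a * b) v.
Proof.
elim/quotW: v => v.
by rewrite -(pi_lquot_scale b v) -!pi_lquot_scale scalerA.
Qed.

Let scale1 : left_id 1 lquot_scale.
Proof. by elim/quotW => v; rewrite -pi_lquot_scale scale1r. Qed.

Let scaleDr : right_distributive lquot_scale +%R.
Proof.
move=> a; elim/quotW => u; elim/quotW => v.
by rewrite -pi_D -!pi_lquot_scale scalerDr pi_D.
Qed.

Let scaleDl v : {morph lquot_scale^~ v : a b / a + b}.
Proof.
by move=> a b; elim/quotW: v => v; rewrite -!pi_lquot_scale scalerDl pi_D.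
Qed.

HB.instance Definition _ :=
  GRing.Zmodule_isLmodule.Build K lquot scaleA scale1 scaleDr scaleDl.

Lemma lquot_piZ a (x : V) : \pi_lquot (a *: x) = a *: \pi_lquot x.
Proof. exact: pi_lquot_scale. Qed.

Lemma lquotP (x y : V) :
  reflect (\pi_lquot x = \pi_lquot y) (x - y \in S).
Proof.
have -> : (x - y \in S) = (x == y %[mod lquot]).
  by rewrite -ring_quotient.Quotient.idealrBE.
exact: eqP.
Qed.

End LinearQuotient.

Section HalfLine.
Variable R : realType.
Local Notation mu := (@lebesgue_measure R).
Implicit Types (f g u w : R -> R[i]) (phi : R -> R).

(* Functions on the half-line are functions on [R] of which only the values on
   [halfline] matter. *)
Definition halfline : set R := `]0, +oo[.

Definition sqnormc (z : R[i]) : R := normc z ^+ 2.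

Definition is_L2 f : Prop :=
  [/\ measurable_fun halfline (fun x => complex.Re (f x)),
      measurable_fun halfline (fun x => complex.Im (f x)) &
      (\int[mu]_(x in halfline) (sqnormc (f x))%:E < +oo)%E].

Definition test_function phi : Prop :=
  (forall k x, derivable (derive1n k phi) x 1) /\
  exists a b : R, 0 < a /\ forall x, ~~ (a <= x <= b) -> phi x = 0.

Definition is_weak_derivR k (u w : R -> R) : Prop :=
  [/\ locally_integrable halfline u, locally_integrable halfline w &
      forall phi, test_function phi ->
        \int[mu]_(x in halfline) (u x * derive1n k phi x) =
        (-1) ^+ k * \int[mu]_(x in halfline) (w x * phi x)].

(* Test functions are real, so the complex identity splits into its real and
   imaginary parts. *)
Definition is_weak_deriv k u w : Prop :=
  is_weak_derivR k (fun x => complex.Re (u x)) (fun x => complex.Re (w x)) /\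
  is_weak_derivR k (fun x => complex.Im (u x)) (fun x => complex.Im (w x)).

Definition weak_deriv k u : R -> R[i] :=
  xget (fun=> 0) [set w | is_weak_deriv k u w].

Definition dotH k u : Prop := exists2 w, is_weak_deriv k u w & is_L2 w.

Definition H1 u : Prop := is_L2 u /\ dotH 1 u.

(* [u] has value [a] at [0]: its representative continuous on [0, +oo[ does. *)
Definition has_trace u (a : R[i]) : Prop :=
  exists g, [/\ {within `[0, +oo[, continuous (fun x => complex.Re (g x))},
                {within `[0, +oo[, continuous (fun x => complex.Im (g x))},
                {ae mu, forall x, halfline x -> u x = g x} & g 0 = a].

Definition trace u : R[i] := xget 0 [set a | has_trace u a].

Lemma sqnormcE (z : R[i]) :
  sqnormc z = complex.Re z ^+ 2 + complex.Im z ^+ 2.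
Proof.
by case: z => a b; rewrite /sqnormc /normc sqr_sqrtr// addr_ge0 ?sqr_ge0.
Qed.

Lemma sqnormc_ge0 (z : R[i]) : 0 <= sqnormc z.
Proof. by rewrite sqnormcE addr_ge0 ?sqr_ge0. Qed.

Lemma normc_ge0 (z : R[i]) : 0 <= normc z.
Proof. by case: z => a b; exact: sqrtr_ge0. Qed.

Lemma ReZD (a b c : R[i]) : complex.Re (a * b + c) =
  complex.Re a * complex.Re b - complex.Im a * complex.Im b + complex.Re c.
Proof. by case: a b c => [? ?] [? ?] [? ?]. Qed.

Lemma ImZD (a b c : R[i]) : complex.Im (a * b + c) =
  complex.Re a * complex.Im b + complex.Im a * complex.Re b + complex.Im c.
Proof. by case: a b c => [? ?] [? ?] [? ?]. Qed.

Lemma measurable_halfline : measurable halfline.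
Proof. exact: measurable_itv. Qed.

Lemma open_halfline : open halfline.
Proof. exact: rray_open. Qed.

Lemma is_L2_0 : is_L2 (fun=> 0).
Proof.
split=> /=; [exact: measurable_cst|exact: measurable_cst|].
by rewrite integral0_eq// => x _; rewrite sqnormcE/= expr0n addr0.
Qed.

Lemma measurable_normc2 f :
  measurable_fun halfline (fun x => complex.Re (f x)) ->
  measurable_fun halfline (fun x => complex.Im (f x)) ->
  measurable_fun halfline (fun x => (sqnormc (f x))%:E).
Proof.
move=> mr mi; apply/measurable_EFinP.
under eq_fun do rewrite sqnormcE.
by apply: measurable_funD; apply: measurable_funX.
Qed.

Lemma is_L2_lin (a : R[i]) f g :
  is_L2 f -> is_L2 g -> is_L2 (fun x => a * f x + g x).
Proof.
move=> [mf1 mf2 f2] [mg1 mg2 g2].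
have m1 : measurable_fun halfline (fun x => complex.Re (a * f x + g x)).
  under eq_fun do rewrite ReZD.
  apply: measurable_funD => //; apply: measurable_funB;
    exact: measurable_funM.
have m2 : measurable_fun halfline (fun x => complex.Im (a * f x + g x)).
  under eq_fun do rewrite ImZD.
  apply: measurable_funD => //; apply: measurable_funD;
    exact: measurable_funM.
split=> //.
set c := 2 * normc a ^+ 2.
have c0 : 0 <= c by rewrite mulr_ge0 ?sqr_ge0.
have mf := measurable_normc2 mf1 mf2.
have mg := measurable_normc2 mg1 mg2.
apply: (@le_lt_trans _ _ (\int[mu]_(x in halfline)
  (c%:E * (sqnormc (f x))%:E + 2%:E * (sqnormc (g x))%:E))%E).
  apply: ge0_le_integral => //=.
  - exact: measurable_halfline.
  - by move=> x _; rewrite lee_fin sqnormc_ge0.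
  - exact: measurable_normc2.
  - by apply: emeasurable_funD; apply: measurable_funeM.
  - move=> x _; rewrite -!EFinM -EFinD lee_fin /c.
    apply: (@le_trans _ _ ((normc a * normc (f x) + normc (g x)) ^+ 2)).
      rewrite /sqnormc ler_pXn2r ?nnegrE ?addr_ge0 ?mulr_ge0 ?normc_ge0//.
      by rewrite -normcM; exact: le_normcD.
    rewrite /sqnormc -subr_ge0; set p := normc _; set q := normc _; set r := normc _.
    rewrite [leRHS](_ : _ = (p * q - r) ^+ 2) ?sqr_ge0//.
    by ring.
rewrite ge0_integralD//=.
- rewrite !ge0_integralZl//=; try by [exact: measurable_halfline
    | move=> x _; rewrite lee_fin sqnormc_ge0].
  by rewrite lte_add_pinfty// lte_mul_pinfty// lee_fin.
- exact: measurable_halfline.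
- by move=> x _; rewrite mule_ge0// lee_fin// sqnormc_ge0.
- exact: measurable_funeM.
- by move=> x _; rewrite mule_ge0// lee_fin// sqnormc_ge0.
- exact: measurable_funeM.
Qed.

Lemma test_function_integrable k (u : R -> R) phi :
  locally_integrable halfline u -> test_function phi ->
  mu.-integrable halfline (EFin \o (fun x => u x * derive1n k phi x)).
Proof.
move=> [mu_ _ lu] [dphi [a [b [a0 supp]]]].
have supp_k i x : ~~ (a <= x <= b) -> derive1n i phi x = 0.
  elim: i x => [|i IH] x xab; first by rewrite derive1n0 supp.
  rewrite derive1nS derive1E (@near_eq_derive _ _ _ _ (cst 0)) ?derive_cst//.
  have [xa|ax] := ltP x a.
    near=> y; apply: IH; rewrite negb_and -!ltNge; apply/orP; left.
    by near: y; exact: lt_nbhsl.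
  have xb : b < x by move: xab; rewrite ax/= -ltNge.
  near=> y; apply: IH; rewrite negb_and -!ltNge; apply/orP; right.
  by near: y; exact: lt_nbhsr.
have cphi : continuous (derive1n k phi).
  move=> x; apply: differentiable_continuous.
  by apply/derivable1_diffP; exact: dphi.
have /compact_bounded : compact (derive1n k phi @` `[a, b]).
  apply: continuous_compact; last exact: segment_compact.
  exact: continuous_subspaceT.
case/pinfty_ex_gt0 => M M0 bM.
have mphi : measurable_fun halfline (derive1n k phi).
  apply: measurable_funTS; exact: continuous_measurable_fun.
have abD : `[a, b] `<=` halfline.
  by move=> x /=; rewrite /halfline/= !in_itv/= andbT => /andP[/(lt_le_trans a0)].
apply/integrableP; split; first by apply/measurable_EFinP; exact: measurable_funM.
apply: (@le_lt_trans _ _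
  (\int[mu]_(x in halfline) ((fun x => M%:E * `|u x|%:E) \_ `[a, b]) x)%E).
  apply: ge0_le_integral => //=.
  - exact: measurable_halfline.
  - by apply/measurable_EFinP; apply: measurableT_comp => //; exact: measurable_funM.
  - apply/(measurable_restrict _ _ _) => //; first exact: measurable_halfline.
    apply: measurable_funeM; apply/measurable_EFinP; apply: measurableT_comp => //.
    by apply: measurable_funS mu_ => //; exact: measurable_halfline.
  - move=> x _; rewrite patchE; case: ifPn => xab.
      rewrite -EFinM lee_fin normrM mulrC ler_wpM2r//.
      by apply: bM; exists x => //; exact: set_mem.
    rewrite supp_k ?mulr0 ?normr0//; apply: contra xab => xab.
    by rewrite inE/= in_itv.
rewrite -integral_mkcondr setIC (setIidl abD) ge0_integralZl//=.
- by rewrite lte_mul_pinfty ?lee_fin ?(ltW M0)//; apply: lu => //; exact: segment_compact.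
- apply/measurable_EFinP; apply: measurableT_comp => //.
  by apply: measurable_funS mu_ => //; exact: measurable_halfline.
- by rewrite lee_fin ltW.
Unshelve. all: by end_near.
Qed.

Lemma locally_integrableZ (a : R) (u : R -> R) :
  locally_integrable halfline u -> locally_integrable halfline (fun x => a * u x).
Proof.
move=> [mu_ oD lu]; split=> //; first exact: measurable_funM.
move=> K KD cK; under eq_integral do rewrite normrM EFinM.
have mK : measurable K by exact: compact_measurable.
rewrite ge0_integralZl//=; first by rewrite lte_mul_pinfty ?lee_fin//; exact: lu.
apply/measurable_EFinP; apply: measurableT_comp => //.
by apply: measurable_funS mu_ => //; exact: measurable_halfline.
Qed.

Lemma is_weak_derivR_lin k (a : R) (u1 w1 u2 w2 : R -> R) :
  is_weak_derivR k u1 w1 -> is_weak_derivR k u2 w2 ->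
  is_weak_derivR k (fun x => a * u1 x + u2 x) (fun x => a * w1 x + w2 x).
Proof.
move=> [lu1 lw1 H1] [lu2 lw2 H2]; split.
- by apply: locally_integrableD => //; exact: locally_integrableZ.
- by apply: locally_integrableD => //; exact: locally_integrableZ.
have mD := measurable_halfline.
have lin i (f g : R -> R) phi : locally_integrable halfline f ->
    locally_integrable halfline g -> test_function phi ->
    \int[mu]_(x in halfline) ((a * f x + g x) * derive1n i phi x) =
    a * \int[mu]_(x in halfline) (f x * derive1n i phi x) +
    \int[mu]_(x in halfline) (g x * derive1n i phi x).
  move=> lf lg tphi; under eq_Rintegral do rewrite mulrDl -mulrA.
  have If := test_function_integrable i lf tphi.
  have Ig := test_function_integrable i lg tphi.
  have aIf : mu.-integrable halfline
      (EFin \o (fun x => a * (f x * derive1n i phi x))).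
    have : mu.-integrable halfline
        (fun x => (a%:E * (f x * derive1n i phi x)%:E)%E).
      exact: integrableZl.
    by [].
  by rewrite RintegralD//= RintegralZl.
move=> phi tphi; rewrite lin// H1// H2//.
by rewrite (lin 0%N w1 w2 phi lw1 lw2 tphi) mulrDr mulrCA.
Qed.

Lemma is_weak_deriv_lin k (a : R[i]) (u1 w1 u2 w2 : R -> R[i]) :
  is_weak_deriv k u1 w1 -> is_weak_deriv k u2 w2 ->
  is_weak_deriv k (fun x => a * u1 x + u2 x) (fun x => a * w1 x + w2 x).
Proof.
move=> [r1 i1] [r2 i2]; split.
- have := is_weak_derivR_lin (complex.Re a) r1
    (is_weak_derivR_lin (- complex.Im a) i1 r2).
  by congr is_weak_derivR; apply/funext => x; rewrite ReZD addrA mulNr.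
- have := is_weak_derivR_lin (complex.Re a) i1
    (is_weak_derivR_lin (complex.Im a) r1 i2).
  by congr is_weak_derivR; apply/funext => x; rewrite ImZD addrA.
Qed.

Lemma dotH_lin k (a : R[i]) u w :
  dotH k u -> dotH k w -> dotH k (fun x => a * u x + w x).
Proof.
move=> [u' du u2] [w' dw w2]; exists (fun x => a * u' x + w' x).
  exact: is_weak_deriv_lin.
exact: is_L2_lin.
Qed.

Lemma has_trace_lin (a b c : R[i]) u w :
  has_trace u b -> has_trace w c ->
  has_trace (fun x => a * u x + w x) (a * b + c).
Proof.
move=> [g [gr gi ug g0]] [h [hr hi wh h0]]; exists (fun x => a * g x + h x).
split=> /=; last by rewrite g0 h0.
- under [X in continuous X]eq_fun do rewrite ReZD.
  move=> x; apply: cvgD; last exact: hr.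
  by apply: cvgB; (apply: cvgM; first exact: cvg_cst); [exact: gr|exact: gi].
- under [X in continuous X]eq_fun do rewrite ImZD.
  move=> x; apply: cvgD; last exact: hi.
  by apply: cvgD; (apply: cvgM; first exact: cvg_cst); [exact: gi|exact: gr].
- have F : Filter (almost_everywhere mu) := ae_filter_ringOfSetsType mu.
  by apply: (@filterS2 _ _ F _ _ _ _ ug wh) => x ugx whx Dx; rewrite ugx// whx.
Qed.

Lemma is_weak_deriv_0 k : is_weak_deriv k (fun=> 0) (fun=> 0).
Proof.
have l0 : locally_integrable halfline (fun=> 0 : R).
  by apply: open_integrable_locally; [exact: open_halfline|exact: integrable0].
have w0 : is_weak_derivR k (fun=> 0) (fun=> 0).
  split=> // phi _; under eq_Rintegral do rewrite mul0r.
  by under [in RHS]eq_Rintegral do rewrite mul0r; rewrite /Rintegral integral0 mulr0.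
by split.
Qed.

Lemma dotH_0 k : dotH k (fun=> 0).
Proof. by exists (fun=> 0); [exact: is_weak_deriv_0|exact: is_L2_0]. Qed.

Lemma has_trace_0 : has_trace (fun=> 0) 0.
Proof.
exists (fun=> 0); split=> //=; last exact: aeW.
- by move=> x; exact: cvg_cst.
- by move=> x; exact: cvg_cst.
Qed.

End HalfLine.

Section StarGraph.
Variables (R : realType) (N : nat).
Local Notation mu := (@lebesgue_measure R).

Definition starfun := 'I_N -> R -> R[i].
HB.instance Definition _ := GRing.Lmodule.on starfun.
HB.instance Definition _ := Choice.on starfun.

Implicit Types u v f : starfun.

Definition in_L2 u : Prop := forall j, is_L2 (u j).

Definition continuous_at_vertex u : Prop :=
  exists a, forall j, has_trace (u j) a.

Definition vertex_value u : R[i] :=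
  xget 0 [set a | forall j, has_trace (u j) a].

Definition in_dotH1 u : Prop :=
  (forall j, dotH 1 (u j)) /\ continuous_at_vertex u.

Definition in_H1 u : Prop :=
  (forall j, H1 (u j)) /\ continuous_at_vertex u.

Definition deriv k u : starfun := fun j => weak_deriv k (u j).

Definition normL2 u : R :=
  Num.sqrt (\sum_(j < N) \int[mu]_(x in @halfline R) (sqnormc (u j x))).

Definition L2_pred : {pred starfun} := fun u => `[< in_L2 u >].
Definition dotH1_pred : {pred starfun} := fun u => `[< in_dotH1 u >].

Lemma L2_pred_submod : submod_closed L2_pred.
Proof.
split=> [|a u v /asboolP uL /asboolP vL]; apply/asboolP => j.
- exact: is_L2_0.
- exact: is_L2_lin.
Qed.

Lemma dotH1_pred_submod : submod_closed dotH1_pred.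
Proof.
split=> [|a u v /asboolP[uH [b ub]] /asboolP[vH [c vc]]]; apply/asboolP; split.
- by move=> j; exact: dotH_0.
- by exists 0 => j; exact: has_trace_0.
- by move=> j; exact: dotH_lin.
- by exists (a * b + c) => j; exact: has_trace_lin.
Qed.

HB.instance Definition _ :=
  GRing.isSubmodClosed.Build R[i] starfun L2_pred L2_pred_submod.
HB.instance Definition _ :=
  GRing.isSubmodClosed.Build R[i] starfun dotH1_pred dotH1_pred_submod.

Definition L2fun := {u : starfun | L2_pred u}.
HB.instance Definition _ := SubChoice.on L2fun.
HB.instance Definition _ := [SubChoice_isSubLmodule of L2fun by <:].

Definition dotH1fun := {u : starfun | dotH1_pred u}.
HB.instance Definition _ := SubChoice.on dotH1fun.
HB.instance Definition _ := [SubChoice_isSubLmodule of dotH1fun by <:].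

Definition L2_null : {pred L2fun} :=
  fun u : L2fun => `[< forall j,
    {ae mu, forall x, halfline x -> val u j x = 0} >].

Definition dotH1_const : {pred dotH1fun} := fun u : dotH1fun =>
  `[< exists c, forall j, {ae mu, forall x, halfline x -> val u j x = c} >].

Lemma L2_null_submod : submod_closed L2_null.
Proof.
have F : Filter (almost_everywhere mu) := ae_filter_ringOfSetsType mu.
split=> [|a u v /asboolP u0 /asboolP v0]; apply/asboolP => j.
  exact: aeW.
apply: (@filterS2 _ _ F _ _ _ _ (u0 j) (v0 j)) => x ux vx Dx.
rewrite (linearP (val : L2fun -> starfun))/=.
by rewrite [LHS](_ : _ = a * val u j x + val v j x) // ux// vx// mulr0 addr0.
Qed.

Lemma dotH1_const_submod : submod_closed dotH1_const.
Proof.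
have F : Filter (almost_everywhere mu) := ae_filter_ringOfSetsType mu.
split=> [|a u v /asboolP[b u0] /asboolP[c v0]]; apply/asboolP.
  by exists 0 => j; exact: aeW.
exists (a * b + c) => j.
apply: (@filterS2 _ _ F _ _ _ _ (u0 j) (v0 j)) => x ux vx Dx.
rewrite (linearP (val : dotH1fun -> starfun))/=.
by rewrite [LHS](_ : _ = a * val u j x + val v j x) // ux// vx.
Qed.

HB.instance Definition _ :=
  GRing.isSubmodClosed.Build R[i] L2fun L2_null L2_null_submod.
HB.instance Definition _ :=
  GRing.isSubmodClosed.Build R[i] dotH1fun dotH1_const dotH1_const_submod.

Definition L2 := lquot (GRing.SubmodClosed.clone R[i] L2fun L2_null _).
HB.instance Definition _ := GRing.Lmodule.on L2.

Definition tildeH1 :=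
  lquot (GRing.SubmodClosed.clone R[i] dotH1fun dotH1_const _).
HB.instance Definition _ := GRing.Lmodule.on tildeH1.

Definition tildeH1_class (x : tildeH1) u : Prop :=
  exists2 w : dotH1fun, val w = u & x = (\pi w)%qT.

Definition L2_class (x : L2) f : Prop :=
  exists2 g : L2fun, val g = f & x = (\pi g)%qT.

Definition energy := (tildeH1 * L2)%type.

Implicit Types T : energy -> energy.

Definition energy_norm (x : energy) : R :=
  Num.sqrt (normL2 (deriv 1 (val (repr x.1))) ^+ 2 +
            normL2 (val (repr x.2)) ^+ 2).

Definition energy_class (x : energy) (uv : starfun * starfun) : Prop :=
  tildeH1_class x.1 uv.1 /\ L2_class x.2 uv.2.

Definition bounded_operator T : Prop :=
  linear T /\ exists M : R, forall x, energy_norm (T x) <= M * energy_norm x.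

Definition opnorm T : \bar R :=
  ereal_sup [set (energy_norm (T x))%:E | x in [set x | energy_norm x <= 1]].

(* Unbounded operators are given by their graphs; [operator D A] is the operator
   with domain (the classes of) [D] that maps the class of [uv] to that of
   [A uv]. *)
Definition operator (D : set (starfun * starfun))
    (A : starfun * starfun -> starfun * starfun) : set (energy * energy) :=
  [set xy | exists uv,
    [/\ D uv, energy_class xy.1 uv & energy_class xy.2 (A uv)]].

(* [T] is the bounded, everywhere defined, two-sided inverse of [W - z]. *)
Definition is_resolvent (W : set (energy * energy)) (z : R[i]) T : Prop :=
  [/\ bounded_operator T,
      forall y, W (T y, y + z *: T y) &
      forall x y, W (x, y) -> T (y - z *: x) = x].

Definition resolvent_set (W : set (energy * energy)) : set R[i] :=
  [set z | exists T, is_resolvent W z T].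

Definition resolvent (W : set (energy * energy)) (z : R[i]) :
  energy -> energy := xget (fun=> 0) [set T | is_resolvent W z T].

Definition wave_dom (alpha : R[i]) : set (starfun * starfun) :=
  [set uv | [/\ in_dotH1 uv.1, forall j, dotH 2 (uv.1 j), in_H1 uv.2 &
    \sum_(j < N) trace (deriv 1 uv.1 j) + alpha * vertex_value uv.2 = 0]].

Definition wave (alpha : R[i]) : set (energy * energy) :=
  operator (wave_dom alpha) (fun uv => (uv.2, deriv 2 uv.1)).

Definition rescale (rho : 'I_N -> R -> R) (n : nat) : 'I_N -> R -> R :=
  fun j x => n%:R * rho j (n%:R * x).

Definition damped_wave_dom : set (starfun * starfun) :=
  [set uv | [/\ in_dotH1 uv.1, forall j, dotH 2 (uv.1 j), in_H1 uv.2 &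
    \sum_(j < N) trace (deriv 1 uv.1 j) = 0]].

(* As the graph lives in [energy * energy], the second component of the action
   has to be in L^2; this is not automatic since [rho j] is only in L^1. *)
Definition damped_wave (alpha : R[i]) (rho : 'I_N -> R -> R) (n : nat) :
    set (energy * energy) :=
  operator damped_wave_dom (fun uv => (uv.2,
    fun j x => deriv 2 uv.1 j x + alpha * (rescale rho n j x)%:C * uv.2 j x)).

End StarGraph.

Arguments wave {R} N alpha.

(* [half_plane false] and [half_plane true] are the open right and left complex
   half-planes. *)
Definition half_plane (R : realType) (s : bool) : set R[i] :=
  [set z | 0 < (-1) ^+ s * complex.Re z].

Definition closed_half_plane (R : realType) (s : bool) : set R[i] :=
  [set z | 0 <= (-1) ^+ s * complex.Re z].

(* Main.v *)
Require Import Defs.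
From mathcomp Require Import all_boot all_order all_algebra ring lra.
From mathcomp Require Import generic_quotient.
From mathcomp Require Import all_classical all_reals all_analysis.
From mathcomp Require Import measurable_realfun complex.
Import Order.TTheory GRing.Theory Num.Theory.
Import numFieldNormedType.Exports.
Local Open Scope classical_set_scope.
Local Open Scope ring_scope.

(** Let (u, v) and (u_n, v_n) represent the images of F under the two resolvents
    and put w = u - u_n, y = v - v_n.  Then y = z w up to a constant,
    w'' = z y - alpha rho^n (y - v), and the values w_j'(0) add up to
    - alpha v(0).  Pairing the second equation with y and integrating by parts on
    each edge gives
      Re z (|w'|^2 + |y|^2)
        = Re alpha int rho^n |y|^2 - Re (alpha int rho^n (v y^* - v(0) y(0)^* )),
    where v(0) y(0)^* may be put under the integral because rho^n has mass 1.
    Since Re z and Re alpha have opposite signs, the term with |y|^2 helps, and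
    |v y^* (x) - v(0) y(0)^*| is at most a constant times sqrt x, by Cauchy-Schwarz.
    Hence |w'|^2 + |y|^2 is bounded by |F| (|w'| + |y|) int sqrt x rho^n, and the
    last integral is n^(-1/2) times the moment of rho. *)

Set Implicit Arguments.
Unset Strict Implicit.
Unset Printing Implicit Defensive.

(** Derivatives and traces are given only through test functions and choice, so each function
    involved is first replaced by [c + prim g]: then [c] is its trace, integration by parts is
    Fubini on a triangle, and the sqrt x modulus is Cauchy-Schwarz on ]0, x]. This replacement rests
    on the du Bois-Reymond lemma, for which smooth bumps are built from exp(-1/x). Since rho is only
    in L^1, the product rho^n v y^* is never integrated alone: the pairing is bounded pointwise
    first, so that only rho^n, sqrt x rho^n and products of L^2 functions are integrated. The
    constant does not depend on n because v is controlled by the resolvent of [wave] alone, while y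
    is controlled by the energy of the difference itself, through y' = z w'. One factor of that norm
    stands on the right against its square on the left, and division closes the estimate. The choice
    of half-plane enters as s = 1 or s = -1, with s Re alpha >= 0 and s Re z < 0. *)

Lemma measurable_hl (R : realType) :
  measurable (@halfline R : set (measurableTypeR R)).
Proof. exact: measurable_halfline. Qed.
Arguments measurable_hl {R}.
Local Hint Extern 0 (measurable _) => solve [exact: measurable_hl] : core.

Lemma integrable_EFinZ (R : realType) (D : set (measurableTypeR R)) (k : R)
    (f : R -> R) : measurable D ->
  (@lebesgue_measure R).-integrable D (EFin \o f) ->
  (@lebesgue_measure R).-integrable D (EFin \o (fun t => k * f t)).
Proof. by move=> mD /(integrableZl mD k). Qed.

Lemma integrable_EFinD (R : realType) (D : set (measurableTypeR R))
    (f h : R -> R) : measurable D ->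
  (@lebesgue_measure R).-integrable D (EFin \o f) ->
  (@lebesgue_measure R).-integrable D (EFin \o h) ->
  (@lebesgue_measure R).-integrable D (EFin \o (fun t => f t + h t)).
Proof. by move=> mD If /(integrableD mD If). Qed.

Local Instance ae_lebesgue_filter (R : realType) :
  Filter (almost_everywhere (@lebesgue_measure R)) := ae_filter_ringOfSetsType _.

(** * Smooth test functions *)

Section Smooth.
Variable R : realType.
Implicit Types (f g : R -> R).

(** Recursion through the first derivative lets the sum and product rules pass to all orders by
    induction. Continuity of the last derivative is not asked, since [smooth] takes every order. *)
Fixpoint Ck (k : nat) f : Prop :=
  if k is k'.+1 then (forall x, derivable f x 1) /\ Ck k' (derive1 f) else True.

Definition smooth f := forall k, Ck k f.

Lemma derive1nSr k f : derive1n k.+1 f = derive1n k (derive1 f).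
Proof. by rewrite /derive1n iterSr. Qed.

Lemma smooth_derivable f : smooth f -> forall k x, derivable (derive1n k f) x 1.
Proof.
move=> sf k; have := sf k.+1; elim: k f {sf} => [|k IH] f [df Cf] x; first exact: df.
by rewrite derive1nSr; exact: IH.
Qed.

Lemma CkS k f : Ck k.+1 f -> Ck k f.
Proof. by elim: k f => [//|k IH] f [df Cf]; split=> //; exact: IH. Qed.

(** Meant for the family [expinv p], whose higher derivatives have no handy closed form but stay in
    the family. *)
Lemma smooth_coind (P : (R -> R) -> Prop) f :
  (forall g, P g -> (forall x, derivable g x 1) /\ P (derive1 g)) -> P f -> smooth f.
Proof.
move=> H Pf k; elim: k f Pf => [//|k IH] f /H[df Pf]; split=> //; exact: IH.
Qed.

Lemma Ck_add k f g : Ck k f -> Ck k g -> Ck k (fun x => f x + g x).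
Proof.
elim: k f g => [//|k IH] f g [df Cf] [dg Cg]; split; first by move=> x; exact: derivableD.
rewrite (_ : derive1 _ = fun x => (derive1 f x) + (derive1 g x)); first exact: IH.
by apply/funext => x; rewrite !derive1E deriveD.
Qed.

Lemma Ck_mul k f g : Ck k f -> Ck k g -> Ck k (fun x => f x * g x).
Proof.
elim: k f g => [//|k IH] f g Cf Cg.
have [[df Cf'] [dg Cg']] := (Cf, Cg).
split; first by move=> x; exact: derivableM.
rewrite (_ : derive1 _ = fun x => (derive1 f x) * g x + f x * (derive1 g x)).
  by apply: Ck_add; apply: IH => //; exact: CkS.
apply/funext => x; rewrite !derive1E deriveM//.
by rewrite /GRing.scale/= addrC mulrC.
Qed.

Lemma Ck_cst k (c : R) : Ck k (fun=> c).
Proof.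
elim: k c => [//|k IH] c; split; first by move=> x; exact: derivable_cst.
rewrite (_ : derive1 _ = fun=> 0); first exact: IH.
by apply/funext => x; rewrite derive1_cst.
Qed.

Lemma smoothD f g : smooth f -> smooth g -> smooth (fun x => f x + g x).
Proof. by move=> sf sg k; exact: Ck_add. Qed.
Lemma smoothM f g : smooth f -> smooth g -> smooth (fun x => f x * g x).
Proof. by move=> sf sg k; exact: Ck_mul. Qed.
Lemma smoothZ (c : R) f : smooth f -> smooth (fun x => c * f x).
Proof. by move=> sf k; apply: Ck_mul => //; exact: Ck_cst. Qed.

Lemma smooth_affine (c d : R) f : smooth f -> smooth (fun x => f (c * x + d)).
Proof.
move=> sf k; elim: k f sf => [//|k IH] f sf.
have df x : derivable f x 1 by have [] := sf 1.
have sf' : smooth (derive1 f) by move=> i; have [] := sf i.+1.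
have D (x : R) : is_derive x (1:R) (fun x : R => f (c * x + d)) (c * (derive1 f) (c * x + d)).
  have Df : is_derive (c * x + d) 1 f ((derive1 f) (c * x + d)).
    by rewrite derive1E; exact/derivableP.
  have Dg : is_derive x (1:R) (fun x : R => c * x + d) c.
    rewrite -[X in is_derive _ _ _ X]addr0; apply: is_deriveD.
    rewrite -[X in is_derive _ _ _ X]mulr1.
    exact: (@is_deriveZ _ _ _ id c x 1 1 (is_derive_id _ _)).
  have := @is_derive1_comp _ f (fun x : R => c * x + d) x _ _ Df Dg.
  by rewrite /GRing.scale/= mulrC.
split; first by move=> x; have [] := D x.
rewrite (_ : derive1 _ = fun x => c * (derive1 f) (c * x + d)).
  by apply: Ck_mul; [exact: Ck_cst|exact: IH].
by apply/funext => x; rewrite derive1E; have [_] := D x.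
Qed.

(** The flat function exp(-1/x), extended by zero; the polynomial factor in 1/x makes the family
    stable under derivation. *)
Definition expinv (p : {poly R}) (x : R) : R :=
  if 0 < x then p.[x^-1] * expR (- x^-1) else 0.

(* t^m e^{-t} is bounded by m! *)
Lemma expinv_bound (p : {poly R}) : exists2 C, 0 <= C & forall x, `|expinv p x| <= C.
Proof.
exists (\sum_(i < size p) `|p`_i| * (i`!)%:R).
  by apply: sumr_ge0 => i _; rewrite mulr_ge0.
move=> x; rewrite /expinv; case: ifPn => [x0|_]; last first.
  by rewrite normr0; apply: sumr_ge0 => i _; rewrite mulr_ge0.
rewrite horner_coef mulr_suml; apply: (le_trans (ler_norm_sum _ _ _)).
apply: ler_sum => i _; rewrite -mulrA normrM ler_wpM2l//.
set t := x^-1; have t0 : 0 < t by rewrite invr_gt0.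
rewrite ger0_norm; last by rewrite mulr_ge0 ?exprn_ge0 ?expR_ge0// ltW.
rewrite expRN ler_pdivrMr ?expR_gt0//.
have t0w := ltW t0.
have f0 : (0 : R) < (i`!)%:R by rewrite ltr0n fact_gt0.

have : t ^+ i / i`!%:R <= expR t.
  case: (nat_of_ord i) => [|k].
    by rewrite expr0 fact0 divr1 (le_trans _ (expR_ge1Dx t))// lerDl.
  by apply: le_trans (expR_ge1Dxn k t0w); rewrite lerDr.
by rewrite ler_pdivrMr// mulrC.
Qed.

(** For x > 0 the chain rule brings out 1/x^2, hence ['X^2]; the exponential contributes p and the
    factor p(1/x) contributes minus the derivative of p. *)
Lemma expinv_derive p x :
  is_derive x (1:R) (expinv p) (expinv ('X^2 * (p - p^`())) x).
Proof.
have [x0|x0|<-] := ltgtP 0 x.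
- have D : is_derive x (1:R) (fun x : R => p.[x^-1] * expR (- x^-1))
    (expinv ('X^2 * (p - p^`())) x).
    have xn0 : x != 0 by rewrite gt_eqF.
    have Di : is_derive x (1:R) (fun x : R => x^-1) (- (x ^- 2)).
      have := @is_deriveV _ id x 1 1 xn0 (is_derive_id _ _).
      by rewrite /GRing.scale/= mulr1.
    have Dp : is_derive x (1:R) (fun x : R => p.[x^-1]) (- (x ^- 2) * p^`().[x^-1]).
      have := @is_derive1_comp _ (fun t => p.[t]) (fun x => x^-1) x _ _ (is_derive_poly p (x^-1)) Di.
      by rewrite /GRing.scale/= mulrC.
    have De : is_derive x (1:R) (fun x : R => expR (- x^-1)) (x ^- 2 * expR (- x^-1)).
      have Dn : is_derive x (1:R) (fun x : R => - x^-1) (x ^- 2).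
        by have := is_deriveN Di; rewrite opprK.
      have := @is_derive1_comp _ expR (fun x : R => - x^-1) x _ _ (is_derive_expR (- x^-1)) Dn.
      by rewrite /GRing.scale/= mulrC.
    have := @is_deriveM _ _ (fun x : R => p.[x^-1]) (fun x : R => expR (- x^-1)) x 1 _ _ Dp De.
    rewrite /GRing.scale/= /expinv x0 hornerM hornerXn hornerD hornerN.
    congr is_derive.
    by rewrite exprVn; ring.
  apply: near_eq_is_derive D.
  near=> y; rewrite /expinv ifT//; near: y; exact: lt_nbhsr.
- rewrite /expinv [in X in is_derive _ _ _ X]ifF; last by rewrite lt_gtF.
  have := is_derive_cst (0:R) x 1.
  apply: near_eq_is_derive.
  near=> y; rewrite ifF//; apply/negbTE; rewrite -leNgt ltW//; near: y; exact: lt_nbhsl.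
- have [C C0 bC] := expinv_bound ('X^2 * p).
  rewrite {2}/expinv ltxx.
  suff H : h^-1 *: ((expinv p \o shift (0:R)) (h *: 1) - expinv p 0) @[h --> 0^'] --> (0 : R).
    apply: DeriveDef; first by apply/cvg_ex; exists 0.
    exact/cvg_lim.
  apply/cvgrPdist_le => e e0.
  near=> h.
  have hn0 : h != 0 by near: h; exact: nbhs_dnbhs_neq.
  rewrite sub0r normrN /= /expinv ltxx subr0 addr0 /GRing.scale/= mulr1.
  case: ifPn => h0; last by rewrite mulr0 normr0 ltW.
  (* Writing 1/h as h / h^2 turns the difference quotient at 0 into h times a bounded function. *)
  have -> : h^-1 * (p.[h^-1] * expR (- h^-1)) = h * expinv ('X^2 * p) h.
    by rewrite /expinv h0 hornerM hornerXn exprVn; field.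
  rewrite normrM (gtr0_norm h0).
  apply: (@le_trans _ _ (h * (C + 1))).
    by rewrite ler_wpM2l ?(ltW h0)// (le_trans (bC _))// lerDl.
  rewrite -ler_pdivlMr; last by rewrite ltr_pwDr.
  have hh : `|h| <= e / (C + 1).
    near: h; apply: dnbhs0_le; rewrite divr_gt0//; by rewrite ltr_pwDr.
  by rewrite -(gtr0_norm h0).
Unshelve. all: by end_near.
Qed.

Lemma expinv_smooth p : smooth (expinv p).
Proof.
apply: (@smooth_coind (fun f => exists p, f = expinv p)); last by exists p.
move=> _ [q ->]; split; first by move=> x; have [] := expinv_derive q x.
exists ('X^2 * (q - q^`())); apply/funext => x; rewrite derive1E.
by have [_] := expinv_derive q x.
Qed.

End Smooth.

(** * Bump functions and the fundamental lemma of the calculus of variations *)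

Section Bump.
Variable R : realType.
Local Notation mu := (@lebesgue_measure R).
Implicit Types (f g h phi : R -> R).

Lemma smooth_test f (a b : R) : smooth f -> 0 < a ->
  (forall x, ~~ (a <= x <= b) -> f x = 0) -> test_function f.
Proof.
move=> sf a0 f0; split; first exact: smooth_derivable.
by exists a, b.
Qed.

Lemma Ck_derive1n k f :
  (forall i x, derivable (derive1n i f) x 1) -> Ck k f.
Proof.
elim: k f => [//|k IH] f df; split; first exact: (df 0%N).
by apply: IH => i x; rewrite -derive1nSr.
Qed.

Lemma test_smooth phi : test_function phi -> smooth phi.
Proof. by move=> [dphi _] k; exact: Ck_derive1n. Qed.

Lemma smooth_continuous f : smooth f -> continuous f.
Proof.
move=> sf x; apply: differentiable_continuous.
by apply/derivable1_diffP; have [df _] := sf 1; exact: df.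
Qed.

(** The support stays in [a, b] for every n: the scaling only steepens the flanks, and as exp(-1/t)
    tends to 1 for large t, the bumps tend to the indicator of ]a, b[. The arguments are put in the
    affine form of [smooth_affine]. *)
Definition smooth_bump (a b : R) (n : nat) (x : R) : R :=
  expinv 1 (n%:R * x + - n%:R * a) * expinv 1 (- n%:R * x + n%:R * b).

Lemma expinv1_ge0_le1 (x : R) : 0 <= expinv 1 x <= 1.
Proof.
rewrite /expinv; case: ifPn => x0; last by rewrite lexx ler01.
by rewrite hornerC mul1r expR_ge0/= -expR0 ler_expR oppr_le0 invr_ge0 ltW.
Qed.

Lemma smooth_bump_ge0_le1 a b n x : 0 <= smooth_bump a b n x <= 1.
Proof.
rewrite /smooth_bump.
have /andP[? ?] := expinv1_ge0_le1 (n%:R * x + - n%:R * a).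
have /andP[? ?] := expinv1_ge0_le1 (- n%:R * x + n%:R * b).
by rewrite mulr_ge0//= mulr_ile1.
Qed.

Lemma smooth_bump_supp a b n x : ~~ (a <= x <= b) -> smooth_bump a b n x = 0.
Proof.
rewrite negb_and -!ltNge /smooth_bump /expinv => /orP[xa|bx].
  rewrite ifF ?mul0r//; apply/negbTE; rewrite -leNgt mulNr -mulrBr.
  by rewrite mulr_ge0_le0// subr_le0 ltW.
rewrite [X in _ * X]ifF ?mulr0//; apply/negbTE; rewrite -leNgt mulNr addrC -mulrBr.
by rewrite mulr_ge0_le0// subr_le0 ltW.
Qed.

Lemma smooth_bump_test a b n : 0 < a -> test_function (smooth_bump a b n).
Proof.
move=> a0; apply: (@smooth_test _ a b) => //; last by move=> x; exact: smooth_bump_supp.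
by apply: smoothM; apply: smooth_affine; exact: expinv_smooth.
Qed.

Lemma cvg_expinv1 (c : R) : 0 < c -> expinv 1 (n%:R * c) @[n --> \oo] --> (1 : R).
Proof.
move=> c0.
have H : expR (- (n.+1%:R * c)^-1) @[n --> \oo] --> (1 : R).
  rewrite -[X in _ --> X]expR0.
  apply: (@cvg_comp _ _ _ _ (@expR R) _ (nbhs (0:R))); last exact: continuous_expR.
  rewrite -oppr0; apply: cvgN.
  have -> : (fun n : nat => (n.+1%:R * c)^-1 : R) = (fun n => n.+1%:R^-1 * c^-1).
    by apply/funext => n; rewrite invfM.
  rewrite -(mul0r c^-1); apply: cvgM; last exact: cvg_cst.
  exact: cvg_harmonic.
rewrite -(cvg_shiftS (fun n => expinv 1 (n%:R * c))).
apply: cvg_trans H; apply: near_eq_cvg; near=> n.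
by rewrite /= /expinv mulr_gt0 ?ltr0Sn// hornerC mul1r.
Unshelve. all: by end_near. Qed.

Lemma cvg_smooth_bump a b x : a < x < b -> smooth_bump a b n x @[n --> \oo] --> (1 : R).
Proof.
move=> /andP[ax xb]; rewrite -(mulr1 1); apply: cvgM.
- have -> : (fun n : nat => expinv 1 (n%:R * x + - n%:R * a)) =
    (fun n => expinv 1 (n%:R * (x - a))).
    by apply/funext => n; rewrite mulNr mulrBr.
  by apply: cvg_expinv1; rewrite subr_gt0.
- have -> : (fun n : nat => expinv 1 (- n%:R * x + n%:R * b)) =
    (fun n => expinv 1 (n%:R * (b - x))).
    by apply/funext => n; rewrite mulNr addrC mulrBr.
  by apply: cvg_expinv1; rewrite subr_gt0.
Qed.

Lemma Rintegral_subset0 (A D : set R) f : A `<=` D ->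
  (forall x, D x -> ~ A x -> f x = 0) ->
  \int[mu]_(x in D) f x = \int[mu]_(x in A) f x.
Proof.
move=> AD f0; rewrite -[in RHS](setIidr AD) Rintegral_mkcondr.
apply: eq_Rintegral => x; rewrite inE => Dx; rewrite patchE.
by case: ifPn => //; rewrite notin_setE => /f0; exact.
Qed.

Lemma locally_integrable_itv h (a b : R) : 0 < a ->
  locally_integrable (@halfline R) h -> mu.-integrable `[a, b] (EFin \o h).
Proof.
move=> a0 [mh _ lh].
have abD : `[a, b] `<=` @halfline R.
  by move=> x /=; rewrite /halfline/= !in_itv/= andbT => /andP[/(lt_le_trans a0)].
apply/integrableP; split.
  by apply/measurable_EFinP; apply: measurable_funS mh.
by apply: lh => //; exact: segment_compact.
Qed.

(** The bumps are bounded by 1 and converge to the indicator of the interval, so dominated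
    convergence passes from test functions to intervals. *)
Lemma locally_integrable_itv0 h (a b : R) :
  locally_integrable (@halfline R) h ->
  (forall phi, test_function phi -> \int[mu]_(x in @halfline R) (h x * phi x) = 0) ->
  0 < a -> \int[mu]_(x in `]a, b[) h x = 0.
Proof.
move=> lh h0 a0.
have ih : mu.-integrable `]a, b[ (EFin \o h).
  apply: integrableS (locally_integrable_itv b a0 lh) => //.
  exact: subset_itv_oo_cc.
have mh : measurable_fun `]a, b[ h by apply/measurable_EFinP; exact: measurable_int ih.
have mb n : measurable_fun `]a, b[ (smooth_bump a b n).
  apply: measurable_funTS; apply: continuous_measurable_fun.
  by apply/smooth_continuous/test_smooth/smooth_bump_test.
have abD : `]a, b[ `<=` @halfline R.
  by move=> x /=; rewrite /halfline/= !in_itv/= andbT => /andP[/(lt_trans a0)].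
have itv_integrable n : (\int[mu]_(x in `]a, b[) (h x * smooth_bump a b n x)%:E = 0)%E.
  have := h0 _ (smooth_bump_test b n a0).
  rewrite (Rintegral_subset0 abD); last first.
    move=> x Dx /= xab; rewrite /smooth_bump /expinv.
    have [ax|xa] := ltP a x; last first.
      rewrite ifF ?mul0r ?mulr0//; apply/negbTE; rewrite -leNgt mulNr -mulrBr.
      by rewrite mulr_ge0_le0// subr_le0.
    have bx : b <= x by rewrite leNgt; apply/negP => xb; apply: xab; rewrite in_itv/= ax xb.
    rewrite [X in _ * (_ * X)]ifF ?mulr0//; apply/negbTE; rewrite -leNgt mulNr addrC -mulrBr.
    by rewrite mulr_ge0_le0// subr_le0.
  rewrite /Rintegral => /eqP; rewrite fine_eq0; last first.
    apply: integrable_fin_num => //.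
    exact: integrableS (test_function_integrable 0 lh (smooth_bump_test b n a0)).
  by move=> /eqP.
have [] := @dominated_convergence _ _ _ mu `]a, b[ (measurable_itv _)
  (fun n x => (h x * smooth_bump a b n x)%:E) (EFin \o h) (fun x => `|h x|%:E).
- move=> n; apply/measurable_EFinP; apply: measurable_funM; [exact: mh|exact: mb].
- exact/measurable_EFinP.
- apply: aeW => x /=; rewrite in_itv/= => xab.
  apply: cvg_EFin; first exact: nearW.
  rewrite /comp/= -[X in _ --> X](mulr1 (h x)); apply: cvgM; first exact: cvg_cst.
  exact: cvg_smooth_bump.
- exact: (integrable_abse ih).
- apply: aeW => x n _; rewrite lee_fin normrM ler_piMr//.
  by have /andP[? ?] := smooth_bump_ge0_le1 a b n x; rewrite ger0_norm.
move=> _ _; under eq_fun do rewrite itv_integrable.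
move=> /(cvg_unique _ (cvg_cst 0%E)) H.
by rewrite /Rintegral -[X in fine X]H.
Qed.

(** On a bounded interval away from 0 the integral function of h vanishes identically, while by
    Lebesgue differentiation its derivative is h almost everywhere. Countably many such intervals
    exhaust the half-line. *)
Lemma fundamental_lemma h : locally_integrable (@halfline R) h ->
  (forall phi, test_function phi -> \int[mu]_(x in @halfline R) (h x * phi x) = 0) ->
  {ae mu, forall x, halfline x -> h x = 0}.
Proof.
move=> lh h0.
suff H (m : nat) : {ae mu, forall x, m.+1%:R^-1 < x < m.+1%:R -> h x = 0}.
  apply: filterS (ae_foralln H) => x Hx; rewrite /halfline/= in_itv/= andbT => x0.
  (* Large enough for both 1 / (m + 1) < x and x < m + 1. *)
  pose m := (Num.truncn (x^-1) + Num.truncn x)%N.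
  apply: (Hx m); apply/andP; split.
    rewrite invf_plt ?posrE// /m; apply: (lt_le_trans (truncnS_gt _)).
    by rewrite ler_nat ltnS leq_addr.
  apply: (lt_le_trans (truncnS_gt _)).
  by rewrite ler_nat ltnS leq_addl.
set a := m.+1%:R^-1 : R; set b := m.+1%:R : R.
have a0 : 0 < a by rewrite invr_gt0.
(* The cut-off is locally integrable on the whole line, as [FTC1] asks; h itself may be singular at
   0. *)
pose hm := h \_ `]a, b[.
have ihm : mu.-integrable setT (EFin \o hm).
  rewrite /hm -restrict_EFin; apply/integrable_restrict => //.
  rewrite setTI; apply: integrableS (locally_integrable_itv b a0 lh) => //.
  exact: subset_itv_oo_cc.
have lhm : locally_integrable setT hm.
  by apply: open_integrable_locally => //; exact: openT.
have ihmy y : mu.-integrable [set` Interval (BRight a) (BRight y)] (EFin \o hm).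
  by apply: integrableS ihm.
have := @FTC1 R hm (BRight a) ihmy lhm.
apply: filterS => x + /andP[ax xb].
rewrite lte_fin => /(_ ax) [_].
rewrite /hm patchE mem_set/= ?in_itv/= ?ax//.
move=> <-; rewrite derive1E (@near_eq_derive _ _ _ _ (cst 0)) ?derive_cst//.
near=> y.
have yb : y < b by near: y; exact: lt_nbhsl.
have iy : mu.-integrable `]a, y[ (EFin \o h).
  apply: integrableS (locally_integrable_itv b a0 lh) => //.
  apply: subset_itv; rewrite bnd_simp//=.
  exact: ltW.
transitivity (\int[mu]_(t in `]a, y]) h t).
  apply: eq_Rintegral => t; rewrite inE/= in_itv/= => /andP[at_ ty].
  by rewrite patchE mem_set//= in_itv/= at_ (le_lt_trans ty).
rewrite -Rintegral_itv_bndo_bndc//.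
exact: locally_integrable_itv0.
Unshelve. all: by end_near. Qed.

End Bump.

(** * Primitives and weak derivatives *)

Section Prim.
Variable R : realType.
Local Notation mu := (@lebesgue_measure R).
Implicit Types (f g h F G : R -> R).

(** Integrability up to the vertex, which [locally_integrable] on the open half-line does not
    give. *)
Definition itv_integrable g := forall X, mu.-integrable `]0, X] (EFin \o g).

(** Being 0 for x <= 0, it is continuous on the whole line, which spares one-sided statements at the
    vertex. *)
Definition prim g x := \int[mu]_(t in `]0, x]) g t.

Lemma itv_integrableD f g : itv_integrable f -> itv_integrable g ->
  itv_integrable (fun x => f x + g x).
Proof.
move=> If Ig X.
have : mu.-integrable `]0, X] ((EFin \o f) \+ (EFin \o g))%E by exact: integrableD.
exact.
Qed.

Lemma itv_integrableZ (c : R) f : itv_integrable f -> itv_integrable (fun x => c * f x).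
Proof.
move=> If X.
have : mu.-integrable `]0, X] (fun x => c%:E * (EFin \o f) x)%E by exact: integrableZl.
exact.
Qed.

Lemma prim_le0 g x : x <= 0 -> prim g x = 0.
Proof. by move=> x0; rewrite /prim set_itv_ge ?Rintegral_set0// bnd_simp -leNgt. Qed.

Lemma primB g x y : itv_integrable g -> 0 <= x -> x <= y ->
  prim g y - prim g x = \int[mu]_(t in `]x, y]) g t.
Proof. by move=> Ig x0 xy; rewrite /prim Rintegral_itvB// bnd_simp. Qed.

Lemma primB_cc g x y : itv_integrable g -> 0 < x -> x <= y ->
  prim g y - prim g x = \int[mu]_(t in `[x, y]) g t.
Proof.
move=> Ig x0 xy; rewrite primB ?(ltW x0)// Rintegral_itv_obnd_cbnd//.
apply: integrableS (Ig y) => //; apply: subset_itvr; rewrite bnd_simp.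
exact: ltW.
Qed.

Lemma prim_continuous g : itv_integrable g -> continuous (prim g).
Proof.
move=> Ig x.
(* Cutting g off to ]0, X] and integrating from - X puts x inside the interval, whatever its
   sign. *)
pose X := `|x| + 1; pose g0 := g \_ `]0, X].
have X0 : 0 < X by rewrite ltr_wpDl.
have mX : - X < X by rewrite gtrN.
have xX : x \in `]-X, X[ by rewrite in_itv/= -ltr_norml /X ltrDl.
have s (y : R) : y <= X -> (`[- X, y] `&` `]0, X] = `]0, y])%classic.
  move=> yX; apply/seteqP; split=> t /=; rewrite !in_itv/=.
    by move=> [/andP[_ ->] /andP[-> _]].
  move=> /andP[t0 ty]; rewrite ty t0/= (le_trans ty yX) andbT.
  by split=> //; apply/ltW/(lt_trans _ t0); rewrite oppr_lt0.
have Ig0 : mu.-integrable `[- X, X] (EFin \o g0).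
  rewrite /g0 -restrict_EFin; apply/integrable_restrict => //.
  by rewrite s//.
have := parameterized_integral_continuous (ltW mX) Ig0.
move=> /(continuous_within_itvP _ mX)[] /(_ x xX) + _ _.
rewrite /parameterized_integral => H.
have E y : y <= X -> \int[mu]_(t in `[- X, y]) g0 t = prim g y.
  by move=> yX; rewrite /g0 -Rintegral_mkcondr s.
rewrite /continuous_at -(E x); last by move: xX; rewrite in_itv/= => /andP[_ /ltW].
apply: cvg_trans H; apply: near_eq_cvg; near=> y.
apply: E; apply: ltW; near: y; apply: lt_nbhsl.
by move: xX; rewrite in_itv/= => /andP[_].
Unshelve. all: by end_near. Qed.

Lemma itv_integrableM_continuous g F : itv_integrable g -> continuous F ->
  itv_integrable (fun x => g x * F x).
Proof.
move=> Ig cF X.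
have mF : measurable_fun `]0, X] F.
  by apply: measurable_funTS; exact: continuous_measurable_fun.
have bF : [bounded F x | x in `]0, X]].
  have /compact_bounded [M [Mr bM]] : compact (F @` `[0, X]).
    by apply: continuous_compact; [exact: continuous_subspaceT|exact: segment_compact].
  exists M; split=> // y My x /= x0X; apply: (bM y My); exists x => //=.
  exact: subset_itv_oc_cc x0X.
have mX : measurable (`]0, X] : set R) by exact: measurable_itv.
have := @integrableMl _ _ _ mu `]0, X] mX (EFin \o g) F (Ig X) mF bF.
exact.
Qed.

Lemma continuous_itv_integrable F : continuous F -> itv_integrable F.
Proof.
move=> cF X; apply: (@integrableS _ _ _ mu `[0, X]) => //.
  exact: subset_itv_oc_cc.
apply: continuous_compact_integrable; first exact: segment_compact.
exact: continuous_subspaceT.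
Qed.

Lemma mem_oc (a b y : R) : (y \in `]a, b]%classic) = (a < y <= b).
Proof. by apply/idP/idP; rewrite inE/= in_itv. Qed.

Lemma mem_cc (a b y : R) : (y \in `[a, b]%classic) = (a <= y <= b).
Proof. by apply/idP/idP; rewrite inE/= in_itv. Qed.

(** Both sides are the double integral of f(x) g(y) over the triangle 0 < y <= x <= X. *)
Lemma prim_fubini f g X : itv_integrable f -> itv_integrable g -> 0 < X ->
  \int[mu]_(x in `]0, X]) (f x * prim g x) =
  \int[mu]_(y in `]0, X]) (g y * (prim f X - prim f y)).
Proof.
move=> If Ig X0.
set D : set R := `]0, X]%classic.
have mD : measurable D by exact: measurable_itv.
pose f1 : measurableTypeR R -> R := f \_ D.
pose g1 : measurableTypeR R -> R := g \_ D.
have If1 : mu.-integrable setT (EFin \o f1).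
  by rewrite /f1 -restrict_EFin; apply/(@integrable_mkcond _ _ _ mu D (EFin \o _)); [exact: mD|exact: If].
have Ig1 : mu.-integrable setT (EFin \o g1).
  by rewrite /g1 -restrict_EFin; apply/(@integrable_mkcond _ _ _ mu D (EFin \o _)); [exact: mD|exact: Ig].
have mf1 : measurable_fun setT f1.
  by apply/measurable_EFinP; exact: measurable_int If1.
have mg1 : measurable_fun setT g1.
  by apply/measurable_EFinP; exact: measurable_int Ig1.
pose k (z : measurableTypeR R * measurableTypeR R) : R :=
  if z.2 <= z.1 then f1 z.1 * g1 z.2 else 0.
pose p (z : measurableTypeR R * measurableTypeR R) : R := f1 z.1 * g1 z.2.
have mp : measurable_fun setT p.
  apply: measurable_funM.
    by apply: (measurableT_comp mf1); exact: measurable_fst.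
  by apply: (measurableT_comp mg1); exact: measurable_snd.
have mk : measurable_fun setT k.
  apply: measurable_fun_ifT => //.
  apply: measurable_fun_ler; [exact: measurable_snd|exact: measurable_fst].
have Ip : (mu \x mu)%E.-integrable setT (EFin \o p).
  apply/integrable12ltyP; first exact/measurable_EFinP.
  have inner x : (\int[mu]_y `|(EFin \o p) (x, y)| =
      `|f1 x|%:E * \int[mu]_y `|g1 y|%:E)%E.
    rewrite -ge0_integralZl//=; last by apply/measurable_EFinP; exact: measurableT_comp.
    by apply: eq_integral => y _; rewrite /p/= normrM EFinM.
  under eq_integral do rewrite inner.
  rewrite ge0_integralZr//=; last 2 first.
  - by apply/measurable_EFinP; exact: measurableT_comp.
  - exact: integral_ge0.
  move/integrableP : If1 => [_ If1]; move/integrableP : Ig1 => [_ Ig1].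
  by apply: lte_mul_pinfty => //; rewrite ?integral_ge0// ge0_fin_numE// integral_ge0.
have Ik : (mu \x mu)%E.-integrable setT (EFin \o k).
  apply: le_integrable Ip => //; first exact/measurable_EFinP.
  by move=> z _ /=; rewrite lee_fin /k /p; case: ifPn => // _; rewrite normr0.
have := Fubini Ik.
have -> : (\int[mu]_x \int[mu]_y (EFin \o k) (x, y) =
    \int[mu]_(x in D) (f x * prim g x)%:E)%E.
  rewrite [RHS]integral_mkcond; apply: eq_integral => x _.
  rewrite restrict_EFin /=.
  rewrite patchE; case: ifPn => xD; last first.
    rewrite integral0_eq// => y _; rewrite /k /f1 /= patchE (negbTE xD) mul0r.
    by case: ifP.
  have /= := set_mem xD; rewrite /D/= in_itv/= => /andP[x0 xX].
  rewrite EFinM /prim /Rintegral fineK; last exact: integrable_fin_num.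
  rewrite -integralZl//=.
  rewrite [RHS]integral_mkcond; apply: eq_integral => y _.
  rewrite /k /f1 /g1 /= !patchE xD !mem_oc.
  case: (leP y x) => yx; rewrite ?andbF//.
  by rewrite (le_trans yx xX) !andbT; case: ifP => _; rewrite ?mulr0.
have -> : (\int[mu]_y \int[mu]_x (EFin \o k) (x, y) =
    \int[mu]_(y in D) (g y * (prim f X - prim f y))%:E)%E.
  rewrite [RHS]integral_mkcond; apply: eq_integral => y _.
  rewrite restrict_EFin /=.
  rewrite patchE; case: ifPn => yD; last first.
    rewrite integral0_eq// => x _; rewrite /k /g1 /= [in X in _ * X]patchE (negbTE yD) mulr0.
    by case: ifP.
  have /= := set_mem yD; rewrite /D/= in_itv/= => /andP[y0 yX].
  have Ify : mu.-integrable `[y, X] (EFin \o f).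
    by apply: integrableS (If X) => //; apply: subset_itvr; rewrite bnd_simp.
  (* The slice of the triangle at height y is [y, X], closed at y, whereas [prim] uses half-open
     intervals. *)
  rewrite primB_cc// EFinM /Rintegral fineK; last exact: integrable_fin_num.
  rewrite -integralZl//=.
  rewrite [RHS]integral_mkcond; apply: eq_integral => x _.
  rewrite /k /f1 /g1 /= !patchE yD.
  rewrite mem_oc mem_cc.
  case: (leP y x) => yx //=.
  by rewrite (lt_le_trans y0 yx)/=; case: ifP => _; rewrite ?mul0r// EFinM muleC.
by move=> H; rewrite /Rintegral H.
Qed.

(** A rearrangement of [prim_fubini]; no pointwise derivative appears, so f and g need only be
    integrable. *)
Lemma prim_ibp f g X : itv_integrable f -> itv_integrable g -> 0 < X ->
  \int[mu]_(x in `]0, X]) (f x * prim g x + g x * prim f x) =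
  prim f X * prim g X.
Proof.
move=> If Ig X0.
have Ifg := itv_integrableM_continuous If (prim_continuous Ig).
have Igf := itv_integrableM_continuous Ig (prim_continuous If).
rewrite RintegralD// prim_fubini//.
have -> : \int[mu]_(y in `]0, X]) (g y * (prim f X - prim f y)) =
   \int[mu]_(y in `]0, X]) (prim f X * g y - g y * prim f y).
  by apply: eq_Rintegral => y _; ring.
rewrite RintegralB// ?RintegralZl//; last exact: itv_integrableZ.
by rewrite /prim subrK.
Qed.

Lemma prim_derive F x : smooth F -> 0 < x -> prim (derive1 F) x = F x - F 0.
Proof.
move=> sF x0.
have dF t : derivable F t 1 by have [df _] := sF 1; exact: df.
have cF : continuous F by exact: smooth_continuous.
have cF' : continuous (derive1 F).
  by apply: smooth_continuous => k; have [] := sF k.+1.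
have := @continuous_FTC2 _ (derive1 F) F 0 x x0 (continuous_subspaceT cF').
rewrite /prim Rintegral_itv_obnd_cbnd; last exact: continuous_itv_integrable.
rewrite /Rintegral => ->//.
split; first by move=> t _; exact: dF.
  by apply: cvg_at_right_filter; exact: cF.
by apply: cvg_at_left_filter; exact: cF.
Qed.

End Prim.

Section Weak.
Variable R : realType.
Local Notation mu := (@lebesgue_measure R).
Implicit Types (f g h u w F G phi psi eta : R -> R).

(** An interval of positive length is not contained in a null set. *)
Lemma ae_halfline_ex (P : R -> Prop) (a b : R) : 0 <= a -> a < b ->
  {ae mu, forall x, halfline x -> P x} -> exists2 x, a < x < b & P x.
Proof.
move=> a0 ab [N [mN N0 PN]]; apply: contrapT => nP.
have : `]a, b[%classic `<=` N.
  move=> x /=; rewrite in_itv/= => axb; apply: PN => /= Px; apply: nP.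
  exists x => //; apply: Px; rewrite /halfline/= in_itv/= andbT.
  by apply: (le_lt_trans a0); case/andP: axb.
have mab : measurable (`]a, b[%classic : set R) by exact: measurable_itv.
move=> abN.
have : (mu `]a, b[%classic <= 0)%E.
  apply: (@le_trans _ _ (mu N)); last by rewrite le_eqVlt; apply/orP; left; apply/eqP.
  by apply: le_measure => //; rewrite inE.
by rewrite lebesgue_measure_itv/= lte_fin ab -EFinD lee_fin subr_le0 leNgt ab.
Qed.

Lemma locally_integrable_continuous F : continuous F ->
  locally_integrable (@halfline R) F.
Proof.
move=> cF; split; [|exact: open_halfline|].
  by apply: measurable_funTS; exact: continuous_measurable_fun.
move=> K _ cK.
have /integrableP[] // : mu.-integrable K (EFin \o F).
apply: continuous_compact_integrable => //.
exact: continuous_subspaceT.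
Qed.

Lemma test_functionD phi psi : test_function phi -> test_function psi ->
  test_function (fun x => phi x + psi x).
Proof.
move=> tphi tpsi.
have [_ [a [b [a0 supp]]]] := tphi; have [_ [c [d [c0 supp']]]] := tpsi.
apply: (@smooth_test _ _ (Num.min a c) (Num.max b d)).
- by apply: smoothD; exact: test_smooth.
- by rewrite lt_min a0.
- move=> x xs; rewrite supp ?supp' ?addr0//; apply: contra xs => /andP[H1 H2];
  by rewrite ge_min le_max H1 H2 ?orbT.
Qed.

Lemma test_functionZ (c : R) phi : test_function phi ->
  test_function (fun x => c * phi x).
Proof.
move=> tphi; have [_ [a [b [a0 supp]]]] := tphi.
apply: (@smooth_test _ _ a b) => //; first by apply: smoothZ; exact: test_smooth.
by move=> x /supp ->; rewrite mulr0.
Qed.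

Lemma test_function_derive phi : test_function phi -> test_function (derive1 phi).
Proof.
move=> [dphi [a [b [a0 supp]]]]; split.
  by move=> k x; rewrite -derive1nSr.
exists a, b; split=> // x xab.
rewrite derive1E (@near_eq_derive _ _ _ _ (cst 0)) ?derive_cst//.
have [xa|ax] := ltP x a.
  near=> y; apply: supp; rewrite negb_and -!ltNge; apply/orP; left.
  by near: y; exact: lt_nbhsl.
have xb : b < x by move: xab; rewrite ax/= -ltNge.
near=> y; apply: supp; rewrite negb_and -!ltNge; apply/orP; right.
by near: y; exact: lt_nbhsr.
Unshelve. all: by end_near. Qed.

Lemma test_continuous phi : test_function phi -> continuous phi.
Proof. by move=> /test_smooth/smooth_continuous. Qed.

Lemma test_integrable u phi : locally_integrable (@halfline R) u ->
  test_function phi ->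
  mu.-integrable (@halfline R) (EFin \o (fun x => u x * phi x)).
Proof. by move=> lu tphi; exact: (test_function_integrable 0 lu tphi). Qed.

(** Otherwise the fundamental lemma would make the constant 1 vanish almost everywhere. *)
Lemma ex_test_Rintegral_neq0 : exists2 psi, test_function psi &
  \int[mu]_(x in @halfline R) psi x != 0.
Proof.
apply: contrapT => H.
have : {ae mu, forall x, halfline x -> (fun=> 1 : R) x = 0}.
  apply: fundamental_lemma; first by apply: locally_integrable_continuous; exact: cst_continuous.
  move=> phi tphi; apply/eqP; apply: contrapT => /negP nz; apply: H.
  exists phi => //; apply: contra nz => /eqP I0; apply/eqP.
  by rewrite -[RHS]I0; apply: eq_Rintegral => x _; rewrite mul1r.
move=> /(ae_halfline_ex (lexx 0) ltr01)[x _ /eqP].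
by rewrite oner_eq0.
Qed.

(** The primitive vanishes to the left of the support in any case; mean zero makes it vanish to the
    right as well. *)
Lemma test_antiderivative eta : test_function eta ->
  \int[mu]_(x in @halfline R) eta x = 0 ->
  test_function (prim eta) /\ derive1 (prim eta) = eta.
Proof.
move=> teta I0; have [_ [a [b [a0 supp]]]] := teta.
have ceta := test_continuous teta.
have prim0 x : x < a -> prim eta x = 0.
  move=> xa; rewrite /prim -[RHS](Rintegral_set0 mu eta).
  rewrite (@Rintegral_subset0 _ set0)//.
  move=> y /=; rewrite in_itv/= => /andP[_ yx] _; apply: supp.
  by rewrite negb_and -ltNge (le_lt_trans yx).
have D (x : R) : derivable (prim eta) x 1 /\ derive1 (prim eta) x = eta x.
  have [xa|ax] := ltP x a.
    have E : \forall y \near x, cst 0 y = prim eta y.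
      by near=> y; rewrite prim0//; near: y; exact: lt_nbhsl.
    have Dx : is_derive x (1:R) (prim eta) 0.
      exact: (near_eq_is_derive E (is_derive_cst (0:R) x 1)).
    split; first by have [] := Dx.
    by rewrite derive1E supp ?negb_and -?ltNge ?xa//; have [_] := Dx.
  have x0 : 0 < x by exact: lt_le_trans ax.
  apply: (@continuous_FTC1 _ eta (BRight 0) x (x + 1)); rewrite ?ltrDl//.
  - exact: (continuous_itv_integrable ceta).
  - exact: ceta.
have D1 : derive1 (prim eta) = eta by apply/funext => x; have [] := D x.
split=> //; apply: (@smooth_test _ _ a b) => //.
  case=> [//|k]; split; first by move=> x; have [] := D x.
  by rewrite D1; exact: test_smooth.
move=> x; rewrite negb_and -!ltNge => /orP[/prim0//|bx].
rewrite -I0 /prim; apply/esym/Rintegral_subset0.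
  by move=> y /=; rewrite /halfline/= !in_itv/= andbT => /andP[].
move=> y; rewrite /halfline/= !in_itv/= andbT => -> /negP /=.
rewrite -ltNge => xy; apply: supp.
by rewrite negb_and -!ltNge (lt_trans bx xy) orbT.
Unshelve. all: by end_near. Qed.

(** The du Bois-Reymond lemma. Subtracting a multiple of a fixed [psi] with integral J nonzero gives
    any test function mean zero, hence makes it the derivative of a test function; the hypothesis
    then says that h - c annihilates every test function. *)
Lemma weak_const h : locally_integrable (@halfline R) h ->
  (forall phi, test_function phi ->
     \int[mu]_(x in @halfline R) (h x * derive1 phi x) = 0) ->
  exists c, {ae mu, forall x, halfline x -> h x = c}.
Proof.
move=> lh H; have [psi tpsi J0] := ex_test_Rintegral_neq0.
set J := \int[mu]_(x in _) psi x in J0.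
have l1 : locally_integrable (@halfline R) (fun=> 1).
  by apply: locally_integrable_continuous; exact: cst_continuous.
have It phi : test_function phi -> mu.-integrable (@halfline R) (EFin \o phi).
  by move=> /(test_integrable l1); under eq_fun do rewrite mul1r.
(* Testing h = c against [psi] forces this value. *)
pose c := (\int[mu]_(x in @halfline R) (h x * psi x)) / J.
exists c.
have lhc : locally_integrable (@halfline R) (fun x => h x + - c).
  apply: locally_integrableD => //.
  by apply: locally_integrable_continuous; exact: cst_continuous.
have := fundamental_lemma lhc.
move=> HH; apply: filterS (HH _) => [x + Dx|].
  by move=> /(_ Dx)/eqP; rewrite subr_eq0 => /eqP.
move=> eta teta {HH}.
set I := \int[mu]_(x in @halfline R) eta x.
have tth := test_functionD teta (test_functionZ (- (I / J)) tpsi).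
have Iz : \int[mu]_(x in @halfline R) (eta x + - (I / J) * psi x) = 0.
  have tz := test_functionZ (- (I / J)) tpsi.
  rewrite RintegralD//; [|exact: It|exact: It].
  by rewrite RintegralZl//; [rewrite -/J -/I; field|exact: It].
have [ta Da] := test_antiderivative tth Iz.
have := H _ ta; rewrite Da.
have -> : \int[mu]_(x in @halfline R) (h x * (eta x + - (I / J) * psi x)) =
  \int[mu]_(x in @halfline R) (h x * eta x + - (I / J) * (h x * psi x)).
  by apply: eq_Rintegral => x _; ring.
rewrite RintegralD//; [|exact: test_integrable|]; last first.
  have := test_integrable lh (test_functionZ (- (I / J)) tpsi).
  by congr (_.-integrable _ _); apply/funext => x /=; congr EFin; ring.
rewrite RintegralZl//; last exact: test_integrable.
have -> : \int[mu]_(x in @halfline R) ((h x + - c) * eta x) =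
  \int[mu]_(x in @halfline R) (h x * eta x + - c * eta x).
  by apply: eq_Rintegral => x _; ring.
rewrite RintegralD//; [|exact: test_integrable|]; last first.
  by have := It _ (test_functionZ (- c) teta).
rewrite RintegralZl//; last exact: It.
by rewrite -/I /c => <-; field.
Qed.

(* An antiderivative of w satisfies the same identity as u by Fubini, so their
   difference has zero weak derivative. *)
Lemma weak_deriv_prim u w : is_weak_derivR 1 u w -> itv_integrable w ->
  exists c, {ae mu, forall x, halfline x -> u x = c + prim w x}.
Proof.
move=> [lu lw H] Iw.
have cP := prim_continuous Iw.
have lP := locally_integrable_continuous cP.
have lh : locally_integrable (@halfline R) (fun x => u x - prim w x).
  exact: locally_integrableB.
have [|c Hc] := weak_const lh; last first.
  exists c; by apply: filterS Hc => x Hx Dx; rewrite -(Hx Dx) subrK.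
move=> phi tphi; have tphi' := test_function_derive tphi.
have -> : \int[mu]_(x in @halfline R) ((u x - prim w x) * derive1 phi x) =
  \int[mu]_(x in @halfline R) (u x * derive1 phi x - prim w x * derive1 phi x).
  by apply: eq_Rintegral => x _; rewrite mulrBl.
rewrite RintegralB//; [|exact: test_integrable|exact: test_integrable].
have := H _ tphi; rewrite derive1n1 expr1 mulN1r => ->.
apply/eqP; rewrite -opprD oppr_eq0; apply/eqP.
rewrite -RintegralD//; [|exact: test_integrable|exact: test_integrable].
have [_ [a [b [a0 supp]]]] := tphi; have [_ [a' [b' [a'0 supp']]]] := tphi'.
(* Past the supports of phi and of its derivative, so that integrals over the half-line reduce to
   ]0, X]. *)
pose X := Num.max `|b| `|b'| + 1.
have X0 : 0 < X by rewrite ltr_wpDl// le_max normr_ge0.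
have bX : b < X by rewrite (le_lt_trans (ler_norm b))// /X ltr_pwDr// le_max lexx.
have b'X : b' < X by rewrite (le_lt_trans (ler_norm b'))// /X ltr_pwDr// le_max lexx orbT.
rewrite (@Rintegral_subset0 _ `]0, X]); last 2 first.
- by move=> y /=; rewrite /halfline/= !in_itv/= andbT => /andP[].
- move=> y; rewrite /halfline/= !in_itv/= andbT => -> /negP /=.
  rewrite -ltNge => Xy; rewrite supp ?supp' ?mulr0 ?addr0// negb_and -!ltNge.
    by rewrite (lt_trans b'X) ?orbT.
  by rewrite (lt_trans bX) ?orbT.
have phi0 : phi 0 = 0 by rewrite supp// negb_and -ltNge a0.
have pE x : 0 < x -> prim (derive1 phi) x = phi x.
  by move=> x0; rewrite prim_derive ?phi0 ?subr0//; exact: test_smooth.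
have := prim_ibp Iw (continuous_itv_integrable (test_continuous tphi')) X0.
rewrite (pE X)// supp ?mulr0; last by rewrite negb_and -!ltNge bX orbT.
move=> I0; rewrite -[RHS]I0; apply: eq_Rintegral => x; rewrite inE/= in_itv/= => /andP[x0 _].
by rewrite pE// [in RHS]mulrC; congr (_ + _); rewrite mulrC.
Qed.

Lemma weak_derivR_uniq k u w1 w2 : is_weak_derivR k u w1 -> is_weak_derivR k u w2 ->
  {ae mu, forall x, halfline x -> w1 x = w2 x}.
Proof.
move=> [lu l1 H1] [_ l2 H2].
apply: filterS (fundamental_lemma (locally_integrableB l1 l2) _).
  by move=> x + Dx => /(_ Dx)/eqP; rewrite subr_eq0 => /eqP.
move=> phi tphi.
have -> : \int[mu]_(x in @halfline R) ((w1 \- w2) x * phi x) =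
  \int[mu]_(x in @halfline R) (w1 x * phi x - w2 x * phi x).
  by apply: eq_Rintegral => x _; rewrite mulrBl.
rewrite RintegralB//; [|exact: test_integrable|exact: test_integrable].
have := H2 _ tphi; rewrite (H1 _ tphi) => /(congr1 (fun t => (-1) ^+ k * t)).
by rewrite !signrMK => ->; rewrite subrr.
Qed.

(** The derivative of a test function is again one: the first-order identity is tested on it and
    compared with the second-order identity. *)
Lemma weak_deriv_2_1 u u1 w : is_weak_derivR 1 u u1 -> is_weak_derivR 2 u w ->
  is_weak_derivR 1 u1 w.
Proof.
move=> [lu l1 H1] [_ l2 H2]; split=> // phi tphi.
have := H1 _ (test_function_derive tphi); have := H2 _ tphi.
rewrite -[2%N]/(1.+1) derive1nSr !derive1n1 => ->.
rewrite expr1 sqrrN expr1n mul1r !mulN1r => ->.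
by rewrite opprK.
Qed.

End Weak.

(** * Estimates for square integrable functions *)

Section Estimates.
Variable R : realType.
Local Notation mu := (@lebesgue_measure R).
Local Notation hl := (@halfline R).
Implicit Types (f g h u w F G phi psi eta : R -> R).

Definition L2R f := measurable_fun hl f /\ mu.-integrable hl (EFin \o (fun x => f x ^+ 2)).

Definition sqn f : R := \int[mu]_(x in hl) (f x ^+ 2).


Lemma L2R_mul f g : L2R f -> L2R g -> mu.-integrable hl (EFin \o (fun x => f x * g x)).
Proof.
move=> [mf If] [mg Ig].
have If2 := integrableD measurable_hl If Ig.
apply: le_integrable If2 => //.
  by apply/measurable_EFinP; exact: measurable_funM.
move=> x _ /=; rewrite lee_fin normrM (ger0_norm (addr_ge0 (sqr_ge0 _) (sqr_ge0 _))).
rewrite -[f x ^+ 2]real_normK ?num_real// -[g x ^+ 2]real_normK ?num_real//.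
have := sqr_ge0 (`|f x| - `|g x|); have := sqr_ge0 (`|f x|); have := sqr_ge0 (`|g x|).
nra.
Qed.

Lemma L2R_lin (a : R) f g : L2R f -> L2R g -> L2R (fun x => a * f x + g x).
Proof.
move=> Lf Lg; have [mf If] := Lf; have [mg Ig] := Lg; split.
  by apply: measurable_funD => //; exact: measurable_funM.
have I1 : mu.-integrable hl (fun x => (a ^+ 2)%:E * (f x ^+ 2)%:E)%E.
  exact: integrableZl.
have I2 : mu.-integrable hl (fun x => (2 * a)%:E * (f x * g x)%:E)%E.
  by apply: integrableZl => //; exact: L2R_mul.
have := integrableD measurable_hl (integrableD measurable_hl I1 I2) Ig.
by congr (_.-integrable _ _); apply/funext => x /=; congr EFin; ring.
Qed.

(** On a bounded interval |f| <= f^2 + 1 suffices. *)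
Lemma L2R_itv_integrable f : L2R f -> itv_integrable f.
Proof.
move=> [mf If] X.
have sX : `]0, X]%classic `<=` hl.
  by move=> x /=; rewrite /halfline/= !in_itv/= andbT => /andP[].
have mX : measurable (`]0, X]%classic : set (measurableTypeR R)) by exact: measurable_itv.
have I1 : mu.-integrable `]0, X] (EFin \o (fun x => f x ^+ 2)).
  exact: integrableS If.
have I2 : mu.-integrable `]0, X] (EFin \o (fun=> 1)).
  by apply: continuous_itv_integrable; exact: cst_continuous.
have I3 := integrableD mX I1 I2.
apply: le_integrable I3 => //.
  by apply/measurable_EFinP; apply: measurable_funS mf.
move=> x _ /=; rewrite lee_fin (ger0_norm (addr_ge0 (sqr_ge0 _) ler01)).
rewrite -[f x ^+ 2]real_normK ?num_real//.
have := sqr_ge0 (`|f x| - 1); have := normr_ge0 (f x); nra.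
Qed.

Lemma sqn_ge0 f : 0 <= sqn f.
Proof. by apply: Rintegral_ge0 => x _; exact: sqr_ge0. Qed.

Lemma integral_itv_le_sqn f x y : L2R f -> 0 <= x ->
  \int[mu]_(t in `]x, y]) (f t ^+ 2) <= sqn f.
Proof.
move=> [mf If] x0.
have sX : `]x, y]%classic `<=` hl.
  move=> t /=; rewrite /halfline/= !in_itv/= andbT => /andP[xt _].
  exact: le_lt_trans xt.
apply: fine_le.
- by apply: integrable_fin_num => //; exact: integrableS If.
- exact: integrable_fin_num.
- apply: ge0_subset_integral => //; first by exact: measurable_int If.
  by move=> t _; rewrite lee_fin sqr_ge0.
Qed.

(* The variance of g over ]x, y] is nonnegative. *)
Lemma primB_sqr_le g x y : L2R g -> 0 <= x -> x <= y ->
  (prim g y - prim g x) ^+ 2 <= (y - x) * \int[mu]_(t in `]x, y]) (g t ^+ 2).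
Proof.
move=> Lg x0; rewrite le_eqVlt => /predU1P[->|xy].
  by rewrite !subrr mul0r expr0n.
have [mg Ig2] := Lg; have Ig := L2R_itv_integrable Lg.
rewrite primB ?(ltW xy)//.
set D := `]x, y]%classic.
have mD : measurable (D : set (measurableTypeR R)) by exact: measurable_itv.
have sD : D `<=` hl.
  move=> t /=; rewrite /D/halfline/= !in_itv/= andbT => /andP[xt _].
  exact: le_lt_trans xt.
have I1 : mu.-integrable D (EFin \o (fun t => g t ^+ 2)) by exact: integrableS Ig2.
have I2 : mu.-integrable D (EFin \o g).
  apply: integrableS (Ig y) => //; apply: subset_itvr; rewrite bnd_simp//.
have I3 : mu.-integrable D (EFin \o (fun=> 1 : R)).
  apply: integrableS (continuous_itv_integrable (@cst_continuous _ _ (1:R)) y) => //.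
  apply: subset_itvr; rewrite bnd_simp//.
set p := \int[mu]_(t in D) g t; set q := \int[mu]_(t in D) (g t ^+ 2).
have yx : 0 < y - x by rewrite subr_gt0.
pose m := p / (y - x).
have muD : mu D = (y - x)%:E by rewrite /D lebesgue_measure_itv/= lte_fin xy.
have mD1 : \int[mu]_(t in D) (1 : R) = y - x.
  by rewrite Rintegral_cst// mul1r [X in fine X]muD.
have : 0 <= \int[mu]_(t in D) ((g t ^+ 2 + (- (2 * m)) * g t) + m ^+ 2 * 1).
  apply: Rintegral_ge0 => t _.
  by rewrite (_ : _ + _ = (g t - m) ^+ 2) ?sqr_ge0//; ring.
have IZ k f := @integrable_EFinZ R _ k f mD.
have ID f h := @integrable_EFinD R _ f h mD.
rewrite RintegralD//; [|by apply: ID => //; exact: IZ|exact: (IZ (m ^+ 2) (fun=> 1))].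
rewrite RintegralD//; [|exact: IZ].
rewrite !RintegralZl// mD1 -/p -/q.
rewrite (_ : _ + _ = q - p ^+ 2 / (y - x)); last by rewrite /m; field; rewrite gt_eqF.
by rewrite subr_ge0 ler_pdivrMr// mulrC.
Qed.

Lemma prim_sqr_le g x : L2R g -> 0 <= x -> prim g x ^+ 2 <= x * sqn g.
Proof.
move=> Lg x0; have := primB_sqr_le Lg (lexx 0) x0.
rewrite (prim_le0 _ (lexx 0)) !subr0 => /le_trans; apply.
by rewrite ler_wpM2l// integral_itv_le_sqn.
Qed.

(** Averages F(x)^2 <= 2 F(t)^2 + 2 (F(t) - F(x))^2 over t in ]x, x + 1], the increment being
    controlled by [primB_sqr_le]. Keeping the integrals local is what later yields decay at
    infinity. *)
Lemma sup_bound_itv (c : R) g x : let F x := c + prim g x in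
  L2R F -> L2R g -> 0 <= x ->
  F x ^+ 2 <= 2 * \int[mu]_(t in `]x, x + 1]) (F t ^+ 2) +
             2 * \int[mu]_(t in `]x, x + 1]) (g t ^+ 2).
Proof.
move=> F LF Lg x0.
set D := `]x, x + 1]%classic.
have mD : measurable (D : set (measurableTypeR R)) by exact: measurable_itv.
have sD : D `<=` hl.
  move=> t /=; rewrite /D/halfline/= !in_itv/= andbT => /andP[xt _].
  exact: le_lt_trans xt.
have x1 : x < x + 1 by rewrite ltrDl.
have [_ IF2] := LF; have [_ Ig2] := Lg.
have I1 : mu.-integrable D (EFin \o (fun t => F t ^+ 2)) by exact: integrableS IF2.
have I2 : mu.-integrable D (EFin \o (fun t => g t ^+ 2)) by exact: integrableS Ig2.
have I3 : mu.-integrable D (EFin \o (fun=> 1 : R)).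
  apply: integrableS (continuous_itv_integrable (@cst_continuous _ _ (1:R)) (x + 1)) => //.
  apply: subset_itvr; rewrite bnd_simp//.
have IZ k f := @integrable_EFinZ R _ k f mD.
have ID f h := @integrable_EFinD R _ f h mD.
have muD : mu D = 1%:E.
  by rewrite /D lebesgue_measure_itv/= lte_fin x1 -EFinB [x + 1]addrC addrK.
have mD1 : \int[mu]_(t in D) (1 : R) = 1.
  by rewrite Rintegral_cst// mul1r [X in fine X]muD.
set q := \int[mu]_(t in D) (g t ^+ 2).
have -> : F x ^+ 2 = \int[mu]_(t in D) (F x ^+ 2 * 1).
  by rewrite RintegralZl// mD1 mulr1.
have -> : 2 * \int[mu]_(t in D) (F t ^+ 2) + 2 * q =
   \int[mu]_(t in D) (2 * F t ^+ 2 + 2 * q * 1).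
  rewrite RintegralD//; [|exact: IZ|exact: (IZ (2 * q) (fun=> 1))].
  by rewrite !RintegralZl// mD1 mulr1.
apply: le_Rintegral => //; [exact: (IZ _ (fun=> 1))|by apply: ID; exact: IZ|].
move=> t; rewrite /D/= in_itv/= => /andP[xt tx1]; rewrite !mulr1.
have q0 : 0 <= q by apply: Rintegral_ge0 => *; exact: sqr_ge0.
have : (prim g t - prim g x) ^+ 2 <= q.
  apply: (le_trans (primB_sqr_le Lg x0 (ltW xt))).
  have H1 : t - x <= 1 by rewrite lerBlDl.
  have H2 : \int[mu]_(s in `]x, t]) (g s ^+ 2) <= q.
    have sub : `]x, t]%classic `<=` D by apply: subset_itvl; rewrite bnd_simp.
    apply: fine_le.
    - by apply: integrable_fin_num => //; exact: integrableS I2.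
    - exact: integrable_fin_num.
    - apply: ge0_subset_integral => //; first by exact: measurable_int I2.
      by move=> s _; rewrite lee_fin sqr_ge0.
  apply: (le_trans _ H2).
  by rewrite ler_piMl//; apply: Rintegral_ge0 => *; exact: sqr_ge0.
rewrite (_ : prim g t - prim g x = F t - F x); last by rewrite /F; ring.
(* 2 F(t)^2 + 2 (F(t) - F(x))^2 - F(x)^2 is exactly this square. *)
have := sqr_ge0 (F x - 2 * F t); nra.
Qed.

Lemma sup_bound (c : R) g x : let F x := c + prim g x in
  L2R F -> L2R g -> 0 <= x -> F x ^+ 2 <= 2 * sqn F + 2 * sqn g.
Proof.
move=> F LF Lg x0; apply: (le_trans (sup_bound_itv LF Lg x0)).
by apply: lerD; rewrite ler_pM2l// integral_itv_le_sqn.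
Qed.

Lemma cvg_Rintegral_halfline h : mu.-integrable hl (EFin \o h) ->
  \int[mu]_(x in `]0, n%:R]) h x @[n --> \oo] --> \int[mu]_(x in hl) h x.
Proof.
move=> Ih; have mh := measurable_int _ Ih.
have mI (n : nat) : measurable (`]0, n%:R]%classic : set (measurableTypeR R)).
  exact: measurable_itv.
have [] := @dominated_convergence _ _ _ mu hl measurable_hl
  (fun n => (EFin \o h) \_ `]0, n%:R]) (EFin \o h) (fun x => `|h x|%:E).
- move=> n; apply/(measurable_restrict _ _ _) => //.
  by apply: measurable_funS mh => //; exact: subIsetl.
- exact: mh.
- apply: aeW => x; rewrite /halfline/= in_itv/= andbT => x0.
  apply: cvg_near_cst.
  exists (Num.truncn x).+1 => // n /= xn.
  rewrite patchE mem_oc x0/= ifT//.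
  by rewrite (le_trans (ltW (truncnS_gt x)))// ler_nat.
- exact: (integrable_abse Ih).
- apply: aeW => x n _; rewrite patchE; case: ifPn => _ //=.
  by rewrite normr0 lee_fin.
move=> _ _.
pose I (n : nat) : set R := `]0, n%:R]%classic.
have E n : (\int[mu]_(x in hl) ((EFin \o h) \_ (I n)) x =
   \int[mu]_(x in I n) (h x)%:E)%E.
  rewrite -integral_mkcondr setIidr// => x /=.
  by rewrite /halfline/= !in_itv/= andbT => /andP[].
under eq_fun do rewrite E.
move=> H.
have fin : (\int[mu]_(x in hl) (h x)%:E)%E \is a fin_num by exact: integrable_fin_num.
apply: fine_cvg.
by rewrite fineK.
Qed.

(** F(n)^2 is at most twice the integral of F^2 + g^2 over ]n, n + 1], a difference of consecutive
    terms of a convergent sequence. Integer points suffice, as the integral over the half-line is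
    also taken as a limit along them. *)
Lemma prim_cvg0 (c : R) g : let F x := c + prim g x in
  L2R F -> L2R g -> F n%:R ^+ 2 @[n --> \oo] --> (0 : R).
Proof.
move=> F LF Lg.
have [_ IF2] := LF; have [_ Ig2] := Lg.
have ID : mu.-integrable hl (EFin \o (fun t => F t ^+ 2 + g t ^+ 2)).
  have := integrableD measurable_hl IF2 Ig2; exact.
have S := cvg_Rintegral_halfline ID.
set s := (fun n : nat => \int[mu]_(x in `]0, n%:R]) (F x ^+ 2 + g x ^+ 2)) in S.
have D : 2 * (s n.+1 - s n) @[n --> \oo] --> (0 : R).
  rewrite -(mulr0 2); apply: cvgM; first exact: cvg_cst.
  rewrite -(subrr (\int[mu]_(x in hl) (F x ^+ 2 + g x ^+ 2))).
  apply: cvgB => //.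
  by rewrite (cvg_shiftS s).
apply: (squeeze_cvgr _ (cvg_cst 0) D); near=> n.
rewrite sqr_ge0/=.
apply: (le_trans (sup_bound_itv LF Lg (ler0n _ n))).
have -> : s n.+1 - s n = \int[mu]_(x in `]n%:R, n%:R + 1]) (F x ^+ 2 + g x ^+ 2).
  rewrite /s -natr1; apply: primB; rewrite ?ler0n ?lerDl// => X.
  apply: integrableS ID => //.
  by move=> x /=; rewrite /halfline/= !in_itv/= andbT => /andP[].
have sub : (`]n%:R, n%:R + 1]%classic : set R) `<=` hl.
  move=> x /=; rewrite /halfline/= !in_itv/= andbT => /andP[+ _].
  exact: le_lt_trans.
rewrite RintegralD//; [|exact: integrableS IF2|exact: integrableS Ig2].
by rewrite mulrDr.
Unshelve. all: by end_near. Qed.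

(** F G tends to 0 along the integers, so only the boundary term at the vertex survives, where F and
    G take the values c and d. *)
Lemma halfline_ibp (c d : R) f g : let F x := c + prim f x in
  let G x := d + prim g x in L2R F -> L2R G -> L2R f -> L2R g ->
  \int[mu]_(x in hl) (f x * G x + g x * F x) = - (c * d).
Proof.
move=> F G LF LG Lf Lg.
have If := L2R_itv_integrable Lf; have Ig := L2R_itv_integrable Lg.
have I : mu.-integrable hl (EFin \o (fun x => f x * G x + g x * F x)).
  have := integrableD measurable_hl (L2R_mul Lf LG) (L2R_mul Lg LF); exact.
have := cvg_Rintegral_halfline I.
have E n : \int[mu]_(x in `]0, n.+1%:R]) (f x * G x + g x * F x) =
    F n.+1%:R * G n.+1%:R - c * d.
  have n0 : (0 : R) < n.+1%:R by [].
  have -> : \int[mu]_(x in `]0, n.+1%:R]) (f x * G x + g x * F x) =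
    \int[mu]_(x in `]0, n.+1%:R]) ((f x * prim g x + g x * prim f x) + (d * f x + c * g x)).
    by apply: eq_Rintegral => x _; rewrite /F /G; ring.
  have I1 := itv_integrableM_continuous If (prim_continuous Ig).
  have I2 := itv_integrableM_continuous Ig (prim_continuous If).
  rewrite RintegralD//; [|exact: itv_integrableD|by apply: itv_integrableD; exact: itv_integrableZ].
  rewrite prim_ibp//.
  rewrite RintegralD//; [|exact: itv_integrableZ|exact: itv_integrableZ].
  rewrite !RintegralZl// /F /G /prim; ring.
rewrite -cvg_shiftS; under eq_fun do rewrite E.
move=> H.
suff K : F n.+1%:R * G n.+1%:R - c * d @[n --> \oo] --> - (c * d).
  exact: (cvg_unique _ H K).
rewrite -[X in _ --> X]add0r; apply: cvgB; last exact: cvg_cst.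
rewrite (cvg_shiftS (fun n => F n%:R * G n%:R)).
have HF := prim_cvg0 LF Lf; have HG := prim_cvg0 LG Lg.
have HFG : F n%:R ^+ 2 + G n%:R ^+ 2 @[n --> \oo] --> (0 : R).
  by rewrite -(addr0 0); exact: cvgD.
apply/cvgr0Pnorm_le => e e0.
move/cvgr0Pnorm_le : HFG => /(_ _ e0); apply: filterS => n.
apply: le_trans; rewrite normrM [leRHS]ger0_norm ?addr_ge0 ?sqr_ge0//.
rewrite -[F _ ^+ 2]real_normK ?num_real// -[G _ ^+ 2]real_normK ?num_real//.
have := sqr_ge0 (`|F n%:R| - `|G n%:R|); have := sqr_ge0 (`|F n%:R|).
have := sqr_ge0 (`|G n%:R|); nra.
Qed.

(** An almost everywhere identity says nothing at 0 itself; but g - [prim w] tends to g 0 there and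
    equals c at points arbitrarily close to 0. *)
Lemma trace_value (c : R) w u g : itv_integrable w ->
  {within `[0, +oo[%classic, continuous g} ->
  {ae mu, forall x, hl x -> u x = c + prim w x} ->
  {ae mu, forall x, hl x -> u x = g x} -> g 0 = c.
Proof.
move=> Iw /continuous_within_itvcyP[_ g0] uw ug.
have gw : {ae mu, forall x, hl x -> g x - prim w x = c}.
  apply: filterS2 uw ug => x ux gx Dx.
  by rewrite -(gx Dx) (ux Dx) addrK.
have H : g x - prim w x @[x --> 0^'+] --> g 0.
  have P0 : prim w x @[x --> 0^'+] --> (0 : R).
    rewrite -[X in _ --> X](prim_le0 w (lexx 0)).
    by apply: cvg_at_right_filter; exact: (prim_continuous Iw).
  by rewrite -[X in _ --> X]subr0; exact: cvgB.
apply/eqP; rewrite -subr_eq0 -normr_eq0 -[_ == _]negbK; apply/negP => n0.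
have e0 : 0 < `|g 0 - c| by rewrite lt_def n0 normr_ge0.
move/cvgrPdist_lt : H => /(_ _ e0); case=> d /= d0 Hd.
have [x /andP[x0 xd] gx] := ae_halfline_ex (lexx 0) d0 gw.
have xB : `|0 - x| < d by rewrite sub0r normrN gtr0_norm.
have := Hd x xB x0; rewrite /= gx; first by rewrite ltxx.
Qed.

End Estimates.

(** * The change of variables x -> k x on the half-line *)

Section Scaling.
Variable R : realType.
Local Notation mu := (@lebesgue_measure R).
Local Notation hl := (@halfline R).
Variables (k : R) (k0 : 0 < k).

Let phi (x : measurableTypeR R) : measurableTypeR R := k * x.

Let mphi : measurable_fun setT phi.
Proof. by apply: measurable_funM => //; exact: measurable_cst. Qed.

Let push : {measure set (measurableTypeR R) -> \bar R} :=
  measure_function_pushforward__canonical__measure_function_Measure mu mphi.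

Let nu := mscale (NngNum (ltW k0)) push.

(** The right-hand side is a measure, [nu], that gives intervals their length, so uniqueness of
    Lebesgue measure applies. *)
Lemma lebesgue_measure_scale (A : set (measurableTypeR R)) : measurable A ->
  mu A = (k%:E * mu (phi @^-1` A))%E.
Proof.
move=> mA; rewrite [LHS](lebesgue_measure_unique (mu := nu))//.
move=> _ [[a b] _ <-] /=; rewrite /nu /mscale/= /push/= /pushforward.
have -> : phi @^-1` `]a, b]%classic = `]a / k, b / k]%classic.
  apply/seteqP; split => x /=; rewrite !in_itv/= /phi ltr_pdivrMr// ler_pdivlMr// mulrC//.
have := lebesgue_measure_itv `]a, b]; have := lebesgue_measure_itv `]a / k, b / k].
rewrite /= => -> ->; rewrite !lte_fin ltr_pM2r ?invr_gt0//.
case: ifP => _; last by rewrite mule0.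
by rewrite -!EFinB -EFinM; congr EFin; field; rewrite gt_eqF.
Qed.

Lemma preimage_scale_halfline : phi @^-1` hl = hl.
Proof.
by apply/seteqP; split=> x; rewrite /phi /halfline/= !in_itv/= !andbT pmulr_rgt0.
Qed.

Lemma measurable_scale (h : R -> R) : measurable_fun hl h ->
  measurable_fun hl (fun x => h (k * x)).
Proof.
move=> mh.
apply: (@measurable_comp _ _ _ _ _ _ hl h hl phi) => //.
  by rewrite -{1}preimage_scale_halfline; exact: image_preimage_subset.
exact: measurable_funTS.
Qed.

Lemma ge0_integral_scale (h : R -> R) : measurable_fun hl h ->
  (forall x, hl x -> 0 <= h x) ->
  (\int[mu]_(x in hl) (k * h (k * x))%:E = \int[mu]_(x in hl) (h x)%:E)%E.
Proof.
move=> mh h0.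
have mh' : measurable_fun hl (EFin \o h) by exact/measurable_EFinP.
rewrite [RHS](eq_measure_integral nu); last first.
  by move=> A mA _; exact: lebesgue_measure_scale.
rewrite ge0_integral_mscale//=.
rewrite (ge0_integral_pushforward mphi)//=; last by move=> y; rewrite inE lee_fin; exact: h0.
rewrite preimage_scale_halfline -ge0_integralZl//=.
- by apply/measurable_EFinP; exact: measurable_scale.
- move=> x; rewrite -{1}preimage_scale_halfline lee_fin; exact: h0.
- by rewrite lee_fin ltW.
Qed.

Lemma ae_scale (P : R -> Prop) : {ae mu, forall x, hl x -> P x} ->
  {ae mu, forall x, hl x -> P (k * x)}.
Proof.
move=> [A [mA A0 PA]]; exists (phi @^-1` A); split.
- by rewrite -[X in measurable X]setTI; exact: mphi.
- have := lebesgue_measure_scale mA; rewrite [X in X = _]A0 => /esym/eqP.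
  by rewrite mule_eq0 eqe gt_eqF//= => /eqP.
- move=> x /= nP; apply: PA => /= H; apply: nP => Dx; apply: H.
  by have := Dx; rewrite -{1}preimage_scale_halfline.
Qed.

End Scaling.

(** * Integrals of functions that agree or compare almost everywhere *)

Section AE.
Variable R : realType.
Local Notation mu := (@lebesgue_measure R).
Local Notation hl := (@halfline R).
Implicit Types f g h : R -> R.


Lemma ae_integrable f g : measurable_fun hl g ->
  {ae mu, forall x, hl x -> f x = g x} ->
  mu.-integrable hl (EFin \o f) -> mu.-integrable hl (EFin \o g).
Proof.
move=> mg fg /integrableP[/measurable_EFinP mf If]; apply/integrableP; split.
  exact/measurable_EFinP.
apply: le_lt_trans If; rewrite le_eqVlt; apply/orP; left; apply/eqP.
apply: ae_eq_integral => //.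
- by apply: measurableT_comp => //; exact/measurable_EFinP.
- by apply: measurableT_comp => //; exact/measurable_EFinP.
- by apply: filterS fg => x H Dx /=; rewrite H.
Qed.

Lemma ae_Rintegral f g : measurable_fun hl f -> measurable_fun hl g ->
  {ae mu, forall x, hl x -> f x = g x} ->
  \int[mu]_(x in hl) f x = \int[mu]_(x in hl) g x.
Proof.
move=> mf mg fg; congr fine; apply: ae_eq_integral => //.
- exact/measurable_EFinP.
- exact/measurable_EFinP.
- by apply: filterS fg => x H Dx /=; rewrite H.
Qed.

(** g - f agrees almost everywhere with its absolute value, whose integral is nonnegative. *)
Lemma ae_le_Rintegral f g : mu.-integrable hl (EFin \o f) ->
  mu.-integrable hl (EFin \o g) ->
  {ae mu, forall x, hl x -> f x <= g x} ->
  \int[mu]_(x in hl) f x <= \int[mu]_(x in hl) g x.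
Proof.
move=> If Ig fg; rewrite -subr_ge0 -RintegralB//.
have mf : measurable_fun hl f by apply/measurable_EFinP; exact: measurable_int If.
have mg : measurable_fun hl g by apply/measurable_EFinP; exact: measurable_int Ig.
rewrite (@ae_Rintegral _ (fun x => `|g x - f x|)).
- by apply: Rintegral_ge0.
- exact: measurable_funB.
- by apply: measurableT_comp => //; exact: measurable_funB.
- by apply: filterS fg => x H Dx; rewrite ger0_norm// subr_ge0 H.
Qed.

Lemma ae_L2R f g : L2R f -> measurable_fun hl g ->
  {ae mu, forall x, hl x -> f x = g x} -> L2R g.
Proof.
move=> [mf If] mg fg; split=> //.
apply: (ae_integrable _ _ If); first exact: measurable_funX.
by apply: filterS fg => x H Dx; rewrite H.
Qed.

Lemma ae_sqn f g : measurable_fun hl f -> measurable_fun hl g ->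
  {ae mu, forall x, hl x -> f x = g x} -> sqn f = sqn g.
Proof.
move=> mf mg fg; apply: ae_Rintegral; [exact: measurable_funX..|].
by apply: filterS fg => x H Dx; rewrite H.
Qed.

(** The pointwise bound (p + q)^2 <= 2 p^2 + 2 q^2 stands in for the triangle inequality, since the
    estimates handle squared norms. *)
Lemma sqn_lin_le (a b : R) f g : L2R f -> L2R g ->
  sqn (fun x => a * f x + b * g x) <= 2 * a ^+ 2 * sqn f + 2 * b ^+ 2 * sqn g.
Proof.
move=> Lf Lg; have [_ If] := Lf; have [_ Ig] := Lg.
have IZ k f := @integrable_EFinZ R _ k f measurable_hl.
have ID f h := @integrable_EFinD R _ f h measurable_hl.
have Lfg : L2R (fun x => a * f x + b * g x).
  apply: L2R_lin => //.
  have L0 : L2R (fun x => b * g x + 0).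
    apply: (L2R_lin b Lg); split; first exact: measurable_cst.
    have := integrable0 mu hl; congr (_.-integrable _ _).
    by apply/funext => x /=; rewrite expr0n.
  by under eq_fun do rewrite -[b * _]addr0.
rewrite /sqn -!RintegralZl// -RintegralD//; [|exact: IZ|exact: IZ].
apply: le_Rintegral => //.
- by have [] := Lfg.
- by apply: ID; exact: IZ.
- by move=> x _; have := sqr_ge0 (a * f x - b * g x); nra.
Qed.

End AE.

(** * The energy estimate on one edge *)

Section Edge.
Variable R : realType.
Local Notation mu := (@lebesgue_measure R).
Local Notation hl := (@halfline R).


Lemma ler_norm_sqr (a b : R) : 0 <= b -> a ^+ 2 <= b ^+ 2 -> `|a| <= b.
Proof.
by move=> b0 ab; rewrite -(@ler_pXn2r _ 2) ?nnegrE// real_normK ?num_real.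
Qed.

Lemma prim_abs_le (g : R -> R) (x S : R) : L2R g -> 0 <= x -> 0 <= S ->
  sqn g <= S ^+ 2 -> `|prim g x| <= Num.sqrt x * S.
Proof.
move=> Lg x0 S0 gS; apply: ler_norm_sqr; first by rewrite mulr_ge0 ?sqrtr_ge0.
by rewrite exprMn sqr_sqrtr// (le_trans (prim_sqr_le Lg x0))// ler_wpM2l.
Qed.

(** The real part of alpha v y^*, where alpha = al1 + i al2, v = v1 + i v2 and y = y1 + i y2. *)
Definition re_dot (al1 al2 v1 v2 y1 y2 : R) : R :=
  al1 * (v1 * y1 + v2 * y2) - al2 * (v2 * y1 - v1 * y2).

(** Splits as (v - n) y + n (y - e). In use, r is sqrt x, n and e are values at the vertex, and S
    and T measure v and y. *)
Lemma mulB_le (v n y e r S T : R) : 0 <= r -> 0 <= S -> 0 <= T ->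
  `|v - n| <= r * S -> `|y| <= T -> `|n| <= S -> `|y - e| <= r * T ->
  `|v * y - n * e| <= 2 * S * T * r.
Proof.
move=> r0 S0 T0 H1 H2 H3 H4.
rewrite (_ : v * y - n * e = (v - n) * y + n * (y - e)); last by ring.
apply: (le_trans (ler_normD _ _)); rewrite !normrM.
rewrite (_ : 2 * S * T * r = r * S * T + S * (r * T)); last by ring.
by apply: lerD; apply: ler_pM.
Qed.

(** Each of al1 and al2 multiplies two products, and each product costs 2 S T r by [mulB_le]: hence
    the 4. *)
Lemma re_dotB_le (al1 al2 v1 v2 y1 y2 n1 n2 e1 e2 r S T : R) :
  0 <= r -> 0 <= S -> 0 <= T ->
  `|v1 - n1| <= r * S -> `|v2 - n2| <= r * S -> `|y1| <= T -> `|y2| <= T ->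
  `|n1| <= S -> `|n2| <= S -> `|y1 - e1| <= r * T -> `|y2 - e2| <= r * T ->
  `|re_dot al1 al2 v1 v2 y1 y2 - re_dot al1 al2 n1 n2 e1 e2| <=
  4 * (`|al1| + `|al2|) * S * T * r.
Proof.
move=> r0 S0 T0 V1 V2 Y1 Y2 N1 N2 E1 E2.
have H11 := mulB_le r0 S0 T0 V1 Y1 N1 E1.
have H22 := mulB_le r0 S0 T0 V2 Y2 N2 E2.
have H21 := mulB_le r0 S0 T0 V2 Y1 N2 E1.
have H12 := mulB_le r0 S0 T0 V1 Y2 N1 E2.
rewrite /re_dot; set c := 2 * S * T * r in H11 H22 H21 H12.
rewrite (_ : _ - _ = al1 * ((v1 * y1 - n1 * e1) + (v2 * y2 - n2 * e2)) -
   al2 * ((v2 * y1 - n2 * e1) - (v1 * y2 - n1 * e2))); last by ring.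
apply: (le_trans (ler_normB _ _)); rewrite !normrM.
rewrite (_ : 4 * _ * S * T * r = `|al1| * (c + c) + `|al2| * (c + c)); last by rewrite /c; ring.
apply: lerD; apply: ler_wpM2l => //.
  by apply: (le_trans (ler_normD _ _)); exact: lerD.
by apply: (le_trans (ler_normB _ _)); exact: lerD.
Qed.

Lemma ibp_pair_sum (b1 b2 p1 p2 c1 c2 q : R) :
  b1 + p1 = - c1 -> b2 + p2 = - c2 -> p1 + p2 = q ->
  b1 + b2 = - (c1 + c2) - q.
Proof. by lra. Qed.

(** I and J stand for the integrals of rho and sqrt u rho, A and Y for squared norms, c for the
    boundary term and w for [re_dot] at the vertex. *)
Lemma energy_balance (s x A Y c w I K J : R) :
  - (s * x) * Y + (s * w * I + - K * J) <= - s * (- c - x * A) ->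
  - (s * x) * (A + Y) <= s * c - s * w * I + K * J.
Proof. by lra. Qed.

Lemma edge_estimate (s x t al1 al2 S T : R) (rho : R -> R)
    (a1 a2 e1 e2 n1 n2 : R) (b1 b2 p1 p2 q1 q2 : R -> R) :
  let A1 u := a1 + prim b1 u in let A2 u := a2 + prim b2 u in
  let Y1 u := e1 + prim p1 u in let Y2 u := e2 + prim p2 u in
  let V1 u := n1 + prim q1 u in let V2 u := n2 + prim q2 u in
  `|s| = 1 -> 0 <= s * al1 -> 0 <= S -> 0 <= T ->
  L2R A1 -> L2R A2 -> L2R b1 -> L2R b2 -> L2R Y1 -> L2R Y2 ->
  L2R p1 -> L2R p2 -> L2R q1 -> L2R q2 ->
  {ae mu, forall u, hl u -> p1 u = x * A1 u - t * A2 u} ->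
  {ae mu, forall u, hl u -> p2 u = t * A1 u + x * A2 u} ->
  {ae mu, forall u, hl u -> b1 u = (x * Y1 u - t * Y2 u) -
     rho u * (al1 * (Y1 u + V1 u) - al2 * (Y2 u + V2 u))} ->
  {ae mu, forall u, hl u -> b2 u = (t * Y1 u + x * Y2 u) -
     rho u * (al2 * (Y1 u + V1 u) + al1 * (Y2 u + V2 u))} ->
  mu.-integrable hl (EFin \o rho) ->
  mu.-integrable hl (EFin \o (fun u => Num.sqrt u * rho u)) ->
  {ae mu, forall u, hl u -> 0 <= rho u} ->
  sqn q1 <= S ^+ 2 -> sqn q2 <= S ^+ 2 -> n1 ^+ 2 <= S ^+ 2 -> n2 ^+ 2 <= S ^+ 2 ->
  sqn p1 <= T ^+ 2 -> sqn p2 <= T ^+ 2 ->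
  2 * sqn Y1 + 2 * sqn p1 <= T ^+ 2 -> 2 * sqn Y2 + 2 * sqn p2 <= T ^+ 2 ->
  - (s * x) * (sqn A1 + sqn A2 + (sqn Y1 + sqn Y2)) <=
  s * (a1 * e1 + a2 * e2)
  - s * re_dot al1 al2 n1 n2 e1 e2 * \int[mu]_(u in hl) rho u
  + 4 * (`|al1| + `|al2|) * S * T * \int[mu]_(u in hl) (Num.sqrt u * rho u).
Proof.
move=> A1 A2 Y1 Y2 V1 V2 s1 sal S0 T0 LA1 LA2 Lb1 Lb2 LY1 LY2 Lp1 Lp2 Lq1 Lq2
  Hp1 Hp2 Hb1 Hb2 Ir Isr r0 Sq1 Sq2 Sn1 Sn2 Tp1 Tp2 TY1 TY2.
set K := 4 * _ * S * T; set E0 := re_dot _ _ _ _ _ _.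
have IZ k f := @integrable_EFinZ R _ k f measurable_hl.
have ID f h := @integrable_EFinD R _ f h measurable_hl.
have [_ IA1] := LA1; have [_ IA2] := LA2; have [_ IY1] := LY1; have [_ IY2] := LY2.
have IbY1 := L2R_mul Lb1 LY1; have IbY2 := L2R_mul Lb2 LY2.
have IpA1 := L2R_mul Lp1 LA1; have IpA2 := L2R_mul Lp2 LA2.
(* Integration by parts trades b Y^* for p A^*, whose real part is x |A|^2 because p = z A. *)
have IB : \int[mu]_(u in hl) (b1 u * Y1 u) + \int[mu]_(u in hl) (b2 u * Y2 u) =
   - (a1 * e1 + a2 * e2) - x * (sqn A1 + sqn A2).
  have H1 := halfline_ibp LA1 LY1 Lb1 Lp1; have H2 := halfline_ibp LA2 LY2 Lb2 Lp2.
  rewrite RintegralD// in H1; rewrite RintegralD// in H2.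
  have H3 : \int[mu]_(u in hl) (p1 u * A1 u) + \int[mu]_(u in hl) (p2 u * A2 u) =
      x * (sqn A1 + sqn A2).
    rewrite -RintegralD// /sqn -RintegralD// -RintegralZl//; last exact: ID.
    apply: ae_Rintegral.
    - by apply/measurable_EFinP; exact: measurable_int (ID _ _ IpA1 IpA2).
    - by apply/measurable_EFinP; exact: measurable_int (IZ x _ (ID _ _ IA1 IA2)).
    - by apply: filterS2 Hp1 Hp2 => u H H' Du; rewrite (H Du) (H' Du); ring.
  exact: ibp_pair_sum H1 H2 H3.
have I1 := IZ (- (s * x)) _ (ID _ _ IY1 IY2).
have I2 := IZ (s * E0) _ Ir; have I3 := IZ (- K) _ Isr.
have I4 := IZ (- s) _ (ID _ _ IbY1 IbY2).
have main : \int[mu]_(u in hl) ((- (s * x)) * (Y1 u ^+ 2 + Y2 u ^+ 2) +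
     (s * E0 * rho u + (- K) * (Num.sqrt u * rho u))) <=
    \int[mu]_(u in hl) ((- s) * (b1 u * Y1 u + b2 u * Y2 u)).
  apply: ae_le_Rintegral.
  - exact: (ID _ _ I1 (ID _ _ I2 I3)).
  - exact: I4.
  apply: filterS3 Hb1 Hb2 r0 => u Hb1 Hb2 r0 Du.
  have u0 : 0 <= u by move: Du; rewrite /halfline/= in_itv/= andbT => /ltW.
  rewrite {}Hb1// {}Hb2//; have {}r0 := r0 Du.
  have su := sqrtr_ge0 u.
  (* Here r = sqrt u: deviations from the vertex values are primitives, bounded by [prim_abs_le],
     and Y itself is bounded by [sup_bound]. *)
  have HK : `|re_dot al1 al2 (V1 u) (V2 u) (Y1 u) (Y2 u) - E0| <= K * Num.sqrt u.
    apply: re_dotB_le => //.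
    - by rewrite /V1 addrC addKr; exact: prim_abs_le.
    - by rewrite /V2 addrC addKr; exact: prim_abs_le.
    - by apply: ler_norm_sqr => //; apply: le_trans TY1; exact: sup_bound.
    - by apply: ler_norm_sqr => //; apply: le_trans TY2; exact: sup_bound.
    - exact: ler_norm_sqr.
    - exact: ler_norm_sqr.
    - by rewrite /Y1 addrC addKr; exact: prim_abs_le.
    - by rewrite /Y2 addrC addKr; exact: prim_abs_le.
  rewrite -subr_ge0.
  rewrite (_ : _ - _ = rho u * (s * al1 * (Y1 u ^+ 2 + Y2 u ^+ 2) +
     (s * (re_dot al1 al2 (V1 u) (V2 u) (Y1 u) (Y2 u) - E0) + K * Num.sqrt u))); last first.
    by rewrite /re_dot; ring.
  apply: mulr_ge0 => //; apply: addr_ge0.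
    by apply: mulr_ge0 => //; rewrite addr_ge0 ?sqr_ge0.
  rewrite -lerBlDr sub0r.
  have : `|s * (re_dot al1 al2 (V1 u) (V2 u) (Y1 u) (Y2 u) - E0)| <= K * Num.sqrt u.
    by rewrite normrM s1 mul1r.
  by rewrite ler_norml => /andP[].
move: main.
rewrite (RintegralD measurable_hl I1 (ID _ _ I2 I3)) (RintegralD measurable_hl I2 I3).
rewrite (RintegralZl _ measurable_hl (ID _ _ IY1 IY2)) (RintegralZl _ measurable_hl Ir).
rewrite (RintegralZl _ measurable_hl Isr).
rewrite (RintegralZl _ measurable_hl (ID _ _ IbY1 IbY2)) (RintegralD measurable_hl IbY1 IbY2) IB.
rewrite (RintegralD measurable_hl IY1 IY2) -/(sqn Y1) -/(sqn Y2).
exact: energy_balance.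
Qed.

End Edge.

(** * Complex-valued functions and the energy space *)

Section ComplexEdge.
Variable R : realType.
Local Notation mu := (@lebesgue_measure R).
Local Notation hl := (@halfline R).
Implicit Types (f g h u w : R -> R[i]).


Definition reF f : R -> R := fun x => complex.Re (f x).
Definition imF f : R -> R := fun x => complex.Im (f x).

Definition ae_eqF f g := {ae mu, forall x, hl x -> f x = g x}.

Lemma complex_eq (z1 z2 : R[i]) : complex.Re z1 = complex.Re z2 ->
  complex.Im z1 = complex.Im z2 -> z1 = z2.
Proof. by case: z1 z2 => [? ?] [? ?] /= -> ->. Qed.

Lemma ae_eqF_components f g : {ae mu, forall x, hl x -> reF f x = reF g x} ->
  {ae mu, forall x, hl x -> imF f x = imF g x} -> ae_eqF f g.
Proof. by apply: filterS2 => x H1 H2 Dx; apply: complex_eq; [exact: H1|exact: H2]. Qed.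

Lemma ae_eqF_Re f g : ae_eqF f g -> {ae mu, forall x, hl x -> reF f x = reF g x}.
Proof. by apply: filterS => x H Dx; rewrite /reF H. Qed.

Lemma ae_eqF_Im f g : ae_eqF f g -> {ae mu, forall x, hl x -> imF f x = imF g x}.
Proof. by apply: filterS => x H Dx; rewrite /imF H. Qed.

Definition csqn f : R := sqn (reF f) + sqn (imF f).

Lemma csqn_ge0 f : 0 <= csqn f.
Proof. by apply: addr_ge0; exact: sqn_ge0. Qed.

Lemma is_L2P f : is_L2 f <-> L2R (reF f) /\ L2R (imF f).
Proof.
split=> [[m1 m2 I2]|[[m1 I1] [m2 I2]]].
  have I : mu.-integrable hl (EFin \o (fun x => sqnormc (f x))).
    apply/integrableP; split; first exact: measurable_normc2.
    by under eq_integral do rewrite /= ger0_norm ?sqnormc_ge0//.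
  split; split=> //; apply: le_integrable I => //.
  - by apply/measurable_EFinP; exact: measurable_funX.
  - move=> x _ /=; rewrite lee_fin !ger0_norm ?sqr_ge0 ?sqnormc_ge0//.
    by rewrite sqnormcE lerDl sqr_ge0.
  - by apply/measurable_EFinP; exact: measurable_funX.
  - move=> x _ /=; rewrite lee_fin !ger0_norm ?sqr_ge0 ?sqnormc_ge0//.
    by rewrite sqnormcE lerDr sqr_ge0.
split=> //.
have /integrableP[_] := integrableD measurable_hl I1 I2.
apply: le_lt_trans; rewrite le_eqVlt; apply/orP; left; apply/eqP.
apply: eq_integral => x _ /=; rewrite sqnormcE ger0_norm//.
by rewrite addr_ge0 ?sqr_ge0.
Qed.

Lemma Rintegral_sqnormc f : is_L2 f -> \int[mu]_(x in hl) sqnormc (f x) = csqn f.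
Proof.
move=> /is_L2P[[_ I1] [_ I2]]; rewrite /csqn /sqn -RintegralD//.
by apply: eq_Rintegral => x _; rewrite sqnormcE.
Qed.

Lemma csqn_ae f g : is_L2 f -> is_L2 g -> ae_eqF f g -> csqn f = csqn g.
Proof.
move=> /is_L2P[[m1 _] [m2 _]] /is_L2P[[m3 _] [m4 _]] fg; congr (_ + _).
  by apply: ae_sqn => //; exact: ae_eqF_Re.
by apply: ae_sqn => //; exact: ae_eqF_Im.
Qed.

Lemma ae_eqF_trans f g h : ae_eqF f g -> ae_eqF g h -> ae_eqF f h.
Proof. by apply: filterS2 => x H1 H2 Dx; rewrite H1// H2. Qed.

Lemma weak_deriv_uniq k u w1 w2 : is_weak_deriv k u w1 -> is_weak_deriv k u w2 ->
  ae_eqF w1 w2.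
Proof.
by move=> [r1 i1] [r2 i2]; apply: ae_eqF_components;
  [exact: (weak_derivR_uniq r1 r2)|exact: (weak_derivR_uniq i1 i2)].
Qed.

(** [weak_deriv] is an arbitrary choice, so its square integrability is carried over from the
    witness in [dotH] by uniqueness almost everywhere. *)
Lemma weak_derivP k u : dotH k u ->
  is_weak_deriv k u (weak_deriv k u) /\ is_L2 (weak_deriv k u).
Proof.
move=> [w uw /is_L2P[w1 w2]].
have D : is_weak_deriv k u (weak_deriv k u).
  by apply: (@xgetPex _ (fun=> 0) [set w | is_weak_deriv k u w]); exists w.
split=> //; apply/is_L2P.
have E := weak_deriv_uniq uw D.
have [[_ [m1 _ _] _] [_ [m2 _ _] _]] := D.
split; first exact: (ae_L2R w1 m1 (ae_eqF_Re E)).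
exact: (ae_L2R w2 m2 (ae_eqF_Im E)).
Qed.

Lemma weak_deriv_linE k (a : R[i]) u v : dotH k u -> dotH k v ->
  ae_eqF (weak_deriv k (fun x => a * u x + v x))
         (fun x => a * weak_deriv k u x + weak_deriv k v x).
Proof.
move=> du dv.
have [D _] := weak_derivP (dotH_lin a du dv).
apply: (weak_deriv_uniq D); apply: is_weak_deriv_lin.
  by have [] := weak_derivP du.
by have [] := weak_derivP dv.
Qed.

(** Tested against phi, the derivative gives - c times the integral of phi', which is zero by
    compact support. *)
Lemma weak_derivR_const (c : R) (h k : R -> R) : is_weak_derivR 1 h k ->
  {ae mu, forall x, hl x -> h x = c} -> {ae mu, forall x, hl x -> k x = 0}.
Proof.
move=> [lh lk H] hc; apply: (fundamental_lemma lk) => phi tphi.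
have tphi' := test_function_derive tphi.
have := H _ tphi; rewrite derive1n1 expr1 mulN1r => /eqP; rewrite -eqr_oppLR => /eqP <-.
have mhd : measurable_fun hl (fun x => h x * derive1 phi x).
  by apply/measurable_EFinP; exact: measurable_int (test_integrable lh tphi').
have md : measurable_fun hl (fun x => c * derive1 phi x).
  apply: measurable_funM; first exact: measurable_cst.
  by apply: measurable_funTS; apply: continuous_measurable_fun; exact: test_continuous.
rewrite (ae_Rintegral mhd md); last by apply: filterS hc => x H' Dx; rewrite H'.
have l1 : locally_integrable hl (fun=> 1).
  by apply: locally_integrable_continuous; exact: cst_continuous.
have I1 : mu.-integrable hl (EFin \o derive1 phi).
  by have := test_integrable l1 tphi'; under eq_fun do rewrite mul1r.
rewrite RintegralZl//.
have [_ [a [b [a0 supp]]]] := tphi; have [_ [a' [b' [a'0 supp']]]] := tphi'.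
pose X := Num.max `|b| `|b'| + 1.
have X0 : 0 < X by rewrite ltr_wpDl// le_max normr_ge0.
have bX : b < X by rewrite (le_lt_trans (ler_norm b))// /X ltr_pwDr// le_max lexx.
have b'X : b' < X by rewrite (le_lt_trans (ler_norm b'))// /X ltr_pwDr// le_max lexx orbT.
rewrite (@Rintegral_subset0 _ `]0, X]); last 2 first.
- by move=> y /=; rewrite /halfline/= !in_itv/= andbT => /andP[].
- move=> y; rewrite /halfline/= !in_itv/= andbT => -> /negP /=.
  rewrite -ltNge => Xy; rewrite supp'// negb_and -!ltNge.
  by rewrite (lt_trans b'X) ?orbT.
rewrite -/(prim (derive1 phi) X) prim_derive//; last exact: test_smooth.
rewrite (supp X) ?(supp 0) ?subrr ?mulr0 ?oppr0//.
  by rewrite negb_and -ltNge a0.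
by rewrite negb_and -!ltNge bX orbT.
Qed.

Lemma weak_deriv_const (c : R[i]) h k : is_weak_deriv 1 h k ->
  ae_eqF h (fun=> c) -> ae_eqF k (fun=> 0).
Proof.
move=> [r i] hc; apply: ae_eqF_components.
  exact: (weak_derivR_const r (ae_eqF_Re hc)).
exact: (weak_derivR_const i (ae_eqF_Im hc)).
Qed.

(** Makes the derivative well defined on classes modulo constants, and turns y = z w + c into y' = z
    w'. *)
Lemma weak_deriv_eq_const (c : R[i]) f g f' g' :
  is_weak_deriv 1 f f' -> is_weak_deriv 1 g g' ->
  ae_eqF f (fun x => g x + c) -> ae_eqF f' g'.
Proof.
move=> df dg fg.
have D := is_weak_deriv_lin (-1) dg df.
have := @weak_deriv_const c _ _ D.
move=> H; apply: filterS (H _) => [x + Dx|].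
  by move=> /(_ Dx); rewrite mulN1r => /eqP; rewrite addrC subr_eq0 => /eqP.
by apply: filterS fg => x Hx Dx; rewrite Hx// mulN1r; ring.
Qed.

Lemma has_trace_ex u g : is_weak_deriv 1 u g -> is_L2 g -> exists a, has_trace u a.
Proof.
move=> [r i] /is_L2P[/L2R_itv_integrable g1 /L2R_itv_integrable g2].
have [c1 H1] := weak_deriv_prim r g1; have [c2 H2] := weak_deriv_prim i g2.
exists (Complex c1 c2).
exists (fun x => Complex (c1 + prim (reF g) x) (c2 + prim (imF g) x)); split=> /=.
- apply: continuous_subspaceT => x; apply: cvgD; first exact: cvg_cst.
  exact: (prim_continuous g1).
- apply: continuous_subspaceT => x; apply: cvgD; first exact: cvg_cst.
  exact: (prim_continuous g2).
- exact: ae_eqF_components.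
- by rewrite !prim_le0// !addr0.
Qed.

Lemma traceP u g : is_weak_deriv 1 u g -> is_L2 g -> has_trace u (trace u).
Proof.
move=> ug L; have [a ua] := has_trace_ex ug L.
by apply: (@xgetPex _ 0 [set a | has_trace u a]); exists a.
Qed.

Lemma has_trace_ae u w a : ae_eqF u w -> has_trace w a -> has_trace u a.
Proof.
move=> uw [g [g1 g2 wg g0]]; exists g; split=> //.
exact: ae_eqF_trans uw wg.
Qed.

(** [weak_deriv_prim] provides some constant, and [trace_value] identifies it with the trace. *)
Lemma has_trace_repr u g a : is_weak_deriv 1 u g -> is_L2 g -> has_trace u a ->
  {ae mu, forall x, hl x -> reF u x = complex.Re a + prim (reF g) x} /\
  {ae mu, forall x, hl x -> imF u x = complex.Im a + prim (imF g) x}.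
Proof.
move=> [r i] /is_L2P[/L2R_itv_integrable g1 /L2R_itv_integrable g2] [k [k1 k2 uk <-]].
have [c1 H1] := weak_deriv_prim r g1; have [c2 H2] := weak_deriv_prim i g2.
have E1 := trace_value g1 k1 H1 (ae_eqF_Re uk).
have E2 := trace_value g2 k2 H2 (ae_eqF_Im uk).
by split; [rewrite E1|rewrite E2].
Qed.

End ComplexEdge.

(** * Representatives of classes and the energy norm *)

Section Quotients.
Variables (R : realType) (N : nat).
Local Notation mu := (@lebesgue_measure R).
Local Notation hl := (@halfline R).
Implicit Types (u v : starfun R N).


Lemma normL2_sqr u : in_L2 u -> normL2 u ^+ 2 = \sum_(j < N) csqn (u j).
Proof.
move=> uL; rewrite /normL2 sqr_sqrtr.
  by apply: eq_bigr => j _; rewrite Rintegral_sqnormc.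
by apply: sumr_ge0 => j _; apply: Rintegral_ge0 => x _; exact: sqnormc_ge0.
Qed.

Lemma tildeH1_class_lin (a : R[i]) (x y : tildeH1 R N) u v :
  tildeH1_class x u -> tildeH1_class y v -> tildeH1_class (a *: x + y) (a *: u + v).
Proof.
move=> [w <- ->] [w' <- ->]; exists (a *: w + w'); first by rewrite linearP.
by rewrite -lquot_piZ raddfD.
Qed.

Lemma L2_class_lin (a : R[i]) (x y : L2 R N) u v :
  L2_class x u -> L2_class y v -> L2_class (a *: x + y) (a *: u + v).
Proof.
move=> [w <- ->] [w' <- ->]; exists (a *: w + w'); first by rewrite linearP.
by rewrite -lquot_piZ raddfD.
Qed.

Lemma tildeH1_class_eq (x : tildeH1 R N) u v :
  tildeH1_class x u -> tildeH1_class x v ->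
  exists c, forall j, ae_eqF (u j) (fun t => v j t + c).
Proof.
move=> [w <- ->] [w' <- /lquotP /asboolP[c H]]; exists c => j.
apply: filterS (H j) => t Ht Dt; rewrite -(Ht Dt).
have -> : val (w - w') = val w - val w' by rewrite raddfB.
by rewrite addrC; exact/esym/subrK.
Qed.

Lemma L2_class_eq (x : L2 R N) u v :
  L2_class x u -> L2_class x v -> forall j, ae_eqF (u j) (v j).
Proof.
move=> [w <- ->] [w' <- /lquotP /asboolP H] j.
apply: filterS (H j) => t Ht Dt; have := Ht Dt.
have -> : val (w - w') = val w - val w' by rewrite raddfB.
by move=> /eqP; rewrite subr_eq0 => /eqP.
Qed.

Lemma tildeH1_class_repr (x : tildeH1 R N) : tildeH1_class x (val (repr x)).
Proof. by exists (repr x); rewrite ?reprK. Qed.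

Lemma L2_class_repr (x : L2 R N) : L2_class x (val (repr x)).
Proof. by exists (repr x); rewrite ?reprK. Qed.

Lemma tildeH1_class_dotH1 (x : tildeH1 R N) u : tildeH1_class x u -> in_dotH1 u.
Proof. by move=> [w <- _]; exact/asboolP/(valP w). Qed.

Lemma L2_class_L2 (x : L2 R N) u : L2_class x u -> in_L2 u.
Proof. by move=> [w <- _]; exact/asboolP/(valP w). Qed.

(** [energy_norm] uses one chosen representative; any other serves because constants have zero
    derivative and [csqn] ignores null sets. *)
Lemma energy_normE (x : energy R N) u v : energy_class x (u, v) ->
  energy_norm x ^+ 2 = \sum_(j < N) csqn (Defs.deriv 1 u j) + \sum_(j < N) csqn (v j).
Proof.
move=> [/= xu xv].
have xr := tildeH1_class_repr x.1; have xs := L2_class_repr x.2.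
have [dr _] := tildeH1_class_dotH1 xr; have [du _] := tildeH1_class_dotH1 xu.
have Ls := L2_class_L2 xs; have Lv := L2_class_L2 xv.
rewrite /energy_norm sqr_sqrtr ?addr_ge0 ?sqr_ge0//.
have LD (w : starfun R N) : (forall j, dotH 1 (w j)) -> in_L2 (Defs.deriv 1 w).
  by move=> dw j; have [] := weak_derivP (dw j).
rewrite (normL2_sqr (LD _ dr)) (normL2_sqr Ls).
have Eu j : csqn (Defs.deriv 1 (val (repr x.1)) j) = csqn (Defs.deriv 1 u j).
  apply: csqn_ae; [exact: LD|exact: LD|].
  have [c H] := tildeH1_class_eq xr xu.
  apply: (weak_deriv_eq_const (c := c) _ _ (H j)).
    by have [] := weak_derivP (dr j).
  by have [] := weak_derivP (du j).
have Ev j : csqn (val (repr x.2) j) = csqn (v j).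
  by apply: csqn_ae; [exact: Ls|exact: Lv|exact: (L2_class_eq xs xv j)].
exact: (congr2 +%R (eq_bigr _ (fun j _ => Eu j)) (eq_bigr _ (fun j _ => Ev j))).
Qed.

Lemma energy_norm_ge0 (x : energy R N) : 0 <= energy_norm x.
Proof. exact: sqrtr_ge0. Qed.

Lemma energy_class_lin (a : R[i]) (x y : energy R N) u v u' v' :
  energy_class x (u, v) -> energy_class y (u', v') ->
  energy_class (a *: x + y) (a *: u + u', a *: v + v').
Proof.
move=> [x1 x2] [y1 y2]; split.
  exact: (tildeH1_class_lin a x1 y1).
exact: (L2_class_lin a x2 y2).
Qed.

End Quotients.

(** * The edge estimate for complex functions, and rescaled weights *)

Section EdgeEstimate.
Variable R : realType.
Local Notation mu := (@lebesgue_measure R).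
Local Notation hl := (@halfline R).


(** The 4 comes from using (p + q)^2 <= 2 p^2 + 2 q^2 twice: for the sum, and inside the real and
    imaginary parts of a f. *)
Lemma csqn_lin_le (a : R[i]) (f g : R -> R[i]) : is_L2 f -> is_L2 g ->
  csqn (fun x => a * f x + g x) <= 4 * sqnormc a * csqn f + 2 * csqn g.
Proof.
move=> /is_L2P[f1 f2] /is_L2P[g1 g2].
have L0 : L2R (fun=> 0 : R) by have /is_L2P[] := is_L2_0 R.
have L1 (k l : R) h1 h2 : L2R h1 -> L2R h2 -> L2R (fun x => k * h1 x + l * h2 x).
  move=> H1 H2; apply: L2R_lin => //.
  have := L2R_lin l H2 L0.
  by under eq_fun do rewrite addr0.
have Lr := L1 (complex.Re a) (- complex.Im a) _ _ f1 f2.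
have Li := L1 (complex.Re a) (complex.Im a) _ _ f2 f1.
have H1 := sqn_lin_le (complex.Re a) (- complex.Im a) f1 f2.
have H2 := sqn_lin_le (complex.Re a) (complex.Im a) f2 f1.
have H3 := sqn_lin_le 1 1 Lr g1.
have H4 := sqn_lin_le 1 1 Li g2.
rewrite /csqn.
have -> : reF (fun x => a * f x + g x) =
  (fun x => 1 * (complex.Re a * reF f x + - complex.Im a * imF f x) + 1 * reF g x).
  by apply/funext => x; rewrite /reF ReZD !mul1r mulNr.
have -> : imF (fun x => a * f x + g x) =
  (fun x => 1 * (complex.Re a * imF f x + complex.Im a * reF f x) + 1 * imF g x).
  by apply/funext => x; rewrite /imF ImZD !mul1r.
rewrite sqnormcE; rewrite !expr1n !mulr1 in H3 H4.
rewrite sqrrN in H1.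
apply: le_trans (lerD H3 H4) _.
set X1 := sqn (fun _ => _) in H1 *; set X2 := sqn (fun x => complex.Re a * imF f x + _) in H2 *.
nra.
Qed.

Lemma csqn0 : csqn (fun=> 0 : R[i]) = 0.
Proof.
rewrite /csqn /sqn /reF /imF /=.
by under eq_Rintegral do rewrite expr0n; rewrite Rintegral_cst// mul0r addr0.
Qed.

Lemma component_bounds (a b c d S : R) : 0 <= a -> 0 <= b -> 0 <= c -> 0 <= d ->
  2 * (a + b) + 2 * (c + d) <= S ->
  [/\ c <= S, d <= S, 2 * a + 2 * c <= S & 2 * b + 2 * d <= S].
Proof. by move=> *; split; lra. Qed.

(** Carries [edge_estimate], whose functions are literally constants plus primitives, over to
    functions that are so only almost everywhere. *)
Lemma edge_estimate_complex (s S T : R) (z alpha a0 e nn : R[i]) (rho : R -> R)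
    (a b y p V q : R -> R[i]) :
  `|s| = 1 -> 0 <= s * complex.Re alpha -> 0 <= S -> 0 <= T ->
  is_weak_deriv 1 a b -> is_L2 a -> is_L2 b -> has_trace a a0 ->
  is_weak_deriv 1 y p -> is_L2 y -> is_L2 p -> has_trace y e ->
  is_weak_deriv 1 V q -> is_L2 V -> is_L2 q -> has_trace V nn ->
  ae_eqF p (fun x => z * a x) ->
  ae_eqF b (fun x => z * y x - alpha * (rho x)%:C%C * (y x + V x)) ->
  mu.-integrable hl (EFin \o rho) ->
  mu.-integrable hl (EFin \o (fun u => Num.sqrt u * rho u)) ->
  {ae mu, forall u, hl u -> 0 <= rho u} ->
  2 * csqn V + 2 * csqn q <= S ^+ 2 -> 2 * csqn y + 2 * csqn p <= T ^+ 2 ->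
  - (s * complex.Re z) * (csqn a + csqn y) <=
  s * (complex.Re a0 * complex.Re e + complex.Im a0 * complex.Im e)
  - s * re_dot (complex.Re alpha) (complex.Im alpha)
      (complex.Re nn) (complex.Im nn) (complex.Re e) (complex.Im e)
    * \int[mu]_(u in hl) rho u
  + 4 * (`|complex.Re alpha| + `|complex.Im alpha|) * S * T
    * \int[mu]_(u in hl) (Num.sqrt u * rho u).
Proof.
move=> s1 sal S0 T0 dab La Lb ta dyp Ly Lp ty dVq LV Lq tV Hp Hb Ir Isr r0 HS HT.
have [A1 A2] := has_trace_repr dab Lb ta.
have [Y1 Y2] := has_trace_repr dyp Lp ty.
have [V1 V2] := has_trace_repr dVq Lq tV.
have [La1 La2] := (is_L2P _).1 La; have [Lb1 Lb2] := (is_L2P _).1 Lb.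
have [Ly1 Ly2] := (is_L2P _).1 Ly; have [Lp1 Lp2] := (is_L2P _).1 Lp.
have [LV1 LV2] := (is_L2P _).1 LV; have [Lq1 Lq2] := (is_L2P _).1 Lq.
have mP (c : R) g : L2R g -> measurable_fun hl (fun x => c + prim g x).
  move=> Lg; apply: measurable_funD; first exact: measurable_cst.
  apply: measurable_funTS; apply: continuous_measurable_fun.
  exact: (prim_continuous (L2R_itv_integrable Lg)).
have LA1 := ae_L2R La1 (mP _ _ Lb1) A1; have LA2 := ae_L2R La2 (mP _ _ Lb2) A2.
have LY1 := ae_L2R Ly1 (mP _ _ Lp1) Y1; have LY2 := ae_L2R Ly2 (mP _ _ Lp2) Y2.
have LW1 := ae_L2R LV1 (mP _ _ Lq1) V1; have LW2 := ae_L2R LV2 (mP _ _ Lq2) V2.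
have EA1 := ae_sqn La1.1 (mP (complex.Re a0) _ Lb1) A1.
have EA2 := ae_sqn La2.1 (mP (complex.Im a0) _ Lb2) A2.
have EY1 := ae_sqn Ly1.1 (mP (complex.Re e) _ Lp1) Y1.
have EY2 := ae_sqn Ly2.1 (mP (complex.Im e) _ Lp2) Y2.
have EV1 := ae_sqn LV1.1 (mP (complex.Re nn) _ Lq1) V1.
have EV2 := ae_sqn LV2.1 (mP (complex.Im nn) _ Lq2) V2.
(* At 0 the primitive vanishes, so this bounds the vertex value of V. *)
have n1 := sup_bound LW1 Lq1 (lexx 0); have n2 := sup_bound LW2 Lq2 (lexx 0).
rewrite /= prim_le0// addr0 -EV1 in n1; rewrite /= prim_le0// addr0 -EV2 in n2.
rewrite {1 2}/csqn in HS; rewrite {1 2}/csqn in HT.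
have [Sq1 Sq2 SV1 SV2] := component_bounds (sqn_ge0 (reF V)) (sqn_ge0 (imF V))
  (sqn_ge0 (reF q)) (sqn_ge0 (imF q)) HS.
have [Tp1 Tp2 TY1 TY2] := component_bounds (sqn_ge0 (reF y)) (sqn_ge0 (imF y))
  (sqn_ge0 (reF p)) (sqn_ge0 (imF p)) HT.
have Sn1 := le_trans n1 SV1; have Sn2 := le_trans n2 SV2.
rewrite EY1 in TY1; rewrite EY2 in TY2.
have Hp1 : {ae mu, forall u, hl u -> reF p u =
    complex.Re z * (complex.Re a0 + prim (reF b) u) -
    complex.Im z * (complex.Im a0 + prim (imF b) u)}.
  apply: filterS3 Hp A1 A2 => x H H1 H2 Dx.
  by rewrite -(H1 Dx) -(H2 Dx) /reF (H Dx) -[z * a x]addr0 ReZD addr0.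
have Hp2 : {ae mu, forall u, hl u -> imF p u =
    complex.Im z * (complex.Re a0 + prim (reF b) u) +
    complex.Re z * (complex.Im a0 + prim (imF b) u)}.
  apply: filterS3 Hp A1 A2 => x H H1 H2 Dx.
  by rewrite -(H1 Dx) -(H2 Dx) /imF (H Dx) -[z * a x]addr0 ImZD addr0 addrC.
have YY : {ae mu, forall x, hl x -> reF y x = complex.Re e + prim (reF p) x /\
    imF y x = complex.Im e + prim (imF p) x}.
  by apply: filterS2 Y1 Y2 => x H1 H2 Dx; rewrite H1// H2.
have VV : {ae mu, forall x, hl x -> reF V x = complex.Re nn + prim (reF q) x /\
    imF V x = complex.Im nn + prim (imF q) x}.
  by apply: filterS2 V1 V2 => x H1 H2 Dx; rewrite H1// H2.
have reE (z1 z2 z3 z4 : R[i]) (r : R) : complex.Re (z1 * z2 - z3 * r%:C%C * (z2 + z4)) =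
   complex.Re z1 * complex.Re z2 - complex.Im z1 * complex.Im z2 -
   r * (complex.Re z3 * (complex.Re z2 + complex.Re z4) -
        complex.Im z3 * (complex.Im z2 + complex.Im z4)).
  by case: z1 z2 z3 z4 => [? ?] [? ?] [? ?] [? ?] /=; ring.
have imE (z1 z2 z3 z4 : R[i]) (r : R) : complex.Im (z1 * z2 - z3 * r%:C%C * (z2 + z4)) =
   complex.Im z1 * complex.Re z2 + complex.Re z1 * complex.Im z2 -
   r * (complex.Im z3 * (complex.Re z2 + complex.Re z4) +
        complex.Re z3 * (complex.Im z2 + complex.Im z4)).
  by case: z1 z2 z3 z4 => [? ?] [? ?] [? ?] [? ?] /=; ring.
have Hb1 : {ae mu, forall u, hl u -> reF b u =
    (complex.Re z * (complex.Re e + prim (reF p) u) -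
     complex.Im z * (complex.Im e + prim (imF p) u)) -
    rho u * (complex.Re alpha * (complex.Re e + prim (reF p) u +
               (complex.Re nn + prim (reF q) u)) -
             complex.Im alpha * (complex.Im e + prim (imF p) u + (complex.Im nn + prim (imF q) u)))}.
  apply: filterS3 YY VV Hb => x H1 H3 H Dx.
  have [<- <-] := H1 Dx; have [<- <-] := H3 Dx.
  by rewrite /reF /imF (H Dx) reE.
have Hb2 : {ae mu, forall u, hl u -> imF b u =
    (complex.Im z * (complex.Re e + prim (reF p) u) +
     complex.Re z * (complex.Im e + prim (imF p) u)) -
    rho u * (complex.Im alpha * (complex.Re e + prim (reF p) u +
               (complex.Re nn + prim (reF q) u)) +
             complex.Re alpha * (complex.Im e + prim (imF p) u + (complex.Im nn + prim (imF q) u)))}.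
  apply: filterS3 YY VV Hb => x H1 H3 H Dx.
  have [<- <-] := H1 Dx; have [<- <-] := H3 Dx.
  by rewrite /reF /imF (H Dx) imE.
have := edge_estimate s1 sal S0 T0 LA1 LA2 Lb1 Lb2 LY1 LY2 Lp1 Lp2 Lq1 Lq2
  Hp1 Hp2 Hb1 Hb2 Ir Isr r0 Sq1 Sq2 Sn1 Sn2 Tp1 Tp2 TY1 TY2.
by rewrite /csqn EA1 EA2 EY1 EY2.
Qed.

Lemma rescale_ae_ge0 (r : R -> R) (k : R) : 0 < k ->
  {ae mu, forall x, hl x -> 0 <= r x} -> {ae mu, forall x, hl x -> 0 <= k * r (k * x)}.
Proof.
by move=> k0 /(ae_scale k0); apply: filterS => x H Dx; rewrite mulr_ge0 ?(ltW k0)// H.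
Qed.

(** The weight is nonnegative only almost everywhere, so the change of variables is applied to its
    absolute value. *)
Lemma scaled_integral (r : R -> R) (k : R) : 0 < k ->
  {ae mu, forall x, hl x -> 0 <= r x} -> mu.-integrable hl (EFin \o r) ->
  mu.-integrable hl (EFin \o (fun x => k * r (k * x))) /\
  \int[mu]_(x in hl) (k * r (k * x)) = \int[mu]_(x in hl) r x.
Proof.
move=> k0 r0 Ir.
have mr : measurable_fun hl r by apply/measurable_EFinP; exact: measurable_int Ir.
have mr' : measurable_fun hl (fun x => `|r x|) by exact: measurableT_comp.
have mk : measurable_fun hl (fun x => k * r (k * x)).
  by apply: measurable_funM; [exact: measurable_cst|exact: measurable_scale].
have mk' : measurable_fun hl (fun x => k * `|r (k * x)|).
  apply: measurable_funM; [exact: measurable_cst|].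
  by apply: measurableT_comp => //; exact: measurable_scale.
have E := ge0_integral_scale k0 mr' (fun x _ => normr_ge0 (r x)).
split.
  apply/integrableP; split; first exact/measurable_EFinP.
  under eq_integral do rewrite /= normrM (gtr0_norm k0).
  by rewrite E; have /integrableP[] := Ir.
rewrite (ae_Rintegral mk mk'); last first.
  by apply: filterS (ae_scale k0 r0) => x H Dx; rewrite ger0_norm// H.
rewrite /Rintegral E -/(Rintegral mu hl (fun x => `|r x|)).
apply: ae_Rintegral => //.
by apply: filterS r0 => x H Dx; rewrite ger0_norm// H.
Qed.

Lemma sqrt_integrable (r : R -> R) :
  {ae mu, forall x, hl x -> 0 <= r x} -> measurable_fun hl r ->
  (\int[mu]_(x in hl) (Num.sqrt x * r x)%:E < +oo)%E ->
  mu.-integrable hl (EFin \o (fun x => Num.sqrt x * r x)).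
Proof.
move=> r0 mr I.
have ms : measurable_fun hl (fun x => Num.sqrt x * r x).
  apply: measurable_funM => //; apply: measurable_funTS.
  by apply: continuous_measurable_fun; exact: sqrt_continuous.
apply/integrableP; split; first exact/measurable_EFinP.
apply: le_lt_trans I; rewrite le_eqVlt; apply/orP; left; apply/eqP.
apply: ae_eq_integral => //.
- by apply: measurableT_comp => //; exact/measurable_EFinP.
- exact/measurable_EFinP.
- apply: filterS r0 => x H Dx /=.
  by rewrite ger0_norm// mulr_ge0 ?sqrtr_ge0// H.
Qed.

(** The origin of the rate: sqrt x = k^(-1/2) sqrt (k x), after which sqrt x r(x) is rescaled like
    any other weight. *)
Lemma scaled_sqrt_integral (r : R -> R) (k : R) : 0 < k ->
  {ae mu, forall x, hl x -> 0 <= r x} ->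
  mu.-integrable hl (EFin \o (fun x => Num.sqrt x * r x)) ->
  mu.-integrable hl (EFin \o (fun x => Num.sqrt x * (k * r (k * x)))) /\
  \int[mu]_(x in hl) (Num.sqrt x * (k * r (k * x))) =
    Num.sqrt k^-1 * \int[mu]_(x in hl) (Num.sqrt x * r x).
Proof.
move=> k0 r0 I.
have sr0 : {ae mu, forall x, hl x -> 0 <= Num.sqrt x * r x}.
  by apply: filterS r0 => x H Dx; rewrite mulr_ge0 ?sqrtr_ge0// H.
have [I' E] := scaled_integral k0 sr0 I.
have F x : Num.sqrt x * (k * r (k * x)) =
    Num.sqrt k^-1 * (k * (Num.sqrt (k * x) * r (k * x))).
  rewrite sqrtrM ?(ltW k0)// sqrtrV ?(ltW k0)//.
  have : Num.sqrt k != 0 by rewrite gt_eqF// sqrtr_gt0.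
  by move=> ?; field.
split.
  have := integrableZl measurable_hl (Num.sqrt k^-1) I'.
  congr (_.-integrable _ _); apply/funext => x /=; by rewrite F.
by under eq_Rintegral do rewrite F; rewrite RintegralZl// E.
Qed.

End EdgeEstimate.

(** * The difference of the resolvents *)

Section Difference.
Variable R : realType.
Local Notation mu := (@lebesgue_measure R).
Local Notation hl := (@halfline R).


Lemma sqnormcN1 : sqnormc (-1 : R[i]) = 1.
Proof. by rewrite sqnormcE /= oppr0 expr0n addr0 sqrrN expr1n. Qed.

Lemma data_bound_sqr (M2 zz cV cq cv cv' cu cf : R) :
  0 <= zz -> 0 <= M2 ->
  cV <= 4 * 1 * cv + 2 * 0 -> cq <= 4 * 1 * cv' + 2 * 0 ->
  cv' <= 4 * zz * cu + 2 * cf -> cv <= M2 -> cu <= M2 -> cf <= 1 ->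
  2 * cV + 2 * cq <= (8 * M2 + 32 * zz * M2 + 16) ^+ 2.
Proof.
move=> z0 M0 H1 H2 H3 H4 H5 H6.
have H7 : zz * cu <= zz * M2 by rewrite ler_wpM2l.
have zM : 0 <= zz * M2 by rewrite mulr_ge0.
apply: (@le_trans _ _ (8 * M2 + 32 * zz * M2 + 16)); first by lra.
by rewrite expr2 ler_peMl; lra.
Qed.

(** Here p = y' = z w', which gives (2 + 8 zz) E^2; the factor is at least 1 and may be squared. *)
Lemma difference_bound_sqr (E2 E zz ca cy cp : R) : 0 <= zz -> E2 = E ^+ 2 ->
  cp <= 4 * zz * ca + 2 * 0 -> ca <= E2 -> cy <= E2 ->
  2 * cy + 2 * cp <= ((2 + 8 * zz) * E) ^+ 2.
Proof.
move=> z0 -> H1 H2 H3.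
have H7 : zz * ca <= zz * E ^+ 2 by rewrite ler_wpM2l.
rewrite exprMn; apply: (@le_trans _ _ ((2 + 8 * zz) * E ^+ 2)); first by lra.
by rewrite ler_wpM2r ?sqr_ge0// expr2 ler_peMl; lra.
Qed.

Lemma weak_deriv12 (u : R -> R[i]) : dotH 1 u -> dotH 2 u ->
  is_weak_deriv 1 (weak_deriv 1 u) (weak_deriv 2 u).
Proof.
move=> /weak_derivP[[r1 i1] _] /weak_derivP[[r2 i2] _]; split.
  exact: (weak_deriv_2_1 r1 r2).
exact: (weak_deriv_2_1 i1 i2).
Qed.

Lemma le_sum_csqn N (f : 'I_N -> R -> R[i]) j : csqn (f j) <= \sum_i csqn (f i).
Proof. by rewrite (bigD1 j)//= lerDl sumr_ge0// => i _; exact: csqn_ge0. Qed.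

Lemma ReD (a b : R[i]) : complex.Re (a + b) = complex.Re a + complex.Re b.
Proof. by case: a b => [? ?] [? ?]. Qed.
Lemma ImD (a b : R[i]) : complex.Im (a + b) = complex.Im a + complex.Im b.
Proof. by case: a b => [? ?] [? ?]. Qed.

Lemma Re_sum N (f : 'I_N -> R[i]) : complex.Re (\sum_j f j) = \sum_j complex.Re (f j).
Proof. exact: (big_morph (@complex.Re R) ReD). Qed.
Lemma Im_sum N (f : 'I_N -> R[i]) : complex.Im (\sum_j f j) = \sum_j complex.Im (f j).
Proof. exact: (big_morph (@complex.Im R) ImD). Qed.

Lemma vertex_valueP N (v : starfun R N) : continuous_at_vertex v ->
  forall j, has_trace (v j) (vertex_value v).
Proof.
move=> [a va].
have := @xgetPex _ (0 : R[i]) [set a | forall j, has_trace (v j) a] (ex_intro _ a va).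
by [].
Qed.

Lemma Re_mul_conj (al nn e : R[i]) :
  complex.Re (al * nn) * complex.Re e + complex.Im (al * nn) * complex.Im e =
  re_dot (complex.Re al) (complex.Im al) (complex.Re nn) (complex.Im nn)
    (complex.Re e) (complex.Im e).
Proof. by case: al nn e => [? ?] [? ?] [? ?]; rewrite /re_dot /=; ring. Qed.

(** The norm bound concerns x alone, the image under the limit resolvent, and the right-hand side
    sees the weight only through its moment m; n will therefore enter through m alone. *)
Lemma energy_difference_le N (r : 'I_N -> R -> R) (s M m : R) (alpha z : R[i])
    (x xn F : energy R N) :
  `|s| = 1 -> 0 <= s * complex.Re alpha ->
  (forall j, mu.-integrable hl (EFin \o r j)) ->
  (forall j, mu.-integrable hl (EFin \o (fun u => Num.sqrt u * r j u))) ->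
  (forall j, {ae mu, forall u, hl u -> 0 <= r j u}) ->
  \sum_j \int[mu]_(u in hl) r j u = 1 ->
  \sum_j \int[mu]_(u in hl) (Num.sqrt u * r j u) = m ->
  wave N alpha (x, F + z *: x) ->
  operator (@damped_wave_dom R N) (fun uv => (uv.2,
    fun j t => Defs.deriv 2 uv.1 j t + alpha * (r j t)%:C%C * uv.2 j t))
    (xn, F + z *: xn) ->
  energy_norm F <= 1 -> energy_norm x <= M ->
  let E := energy_norm (x - xn) in
  - (s * complex.Re z) * E ^+ 2 <=
  4 * (`|complex.Re alpha| + `|complex.Im alpha|) *
    (8 * M ^+ 2 + 32 * sqnormc z * M ^+ 2 + 16) * ((2 + 8 * sqnormc z) * E) * m.
Proof.
move=> s1 sal Ir Isr r0 r1 rm.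
case=> -[u v] [/= [[du cu] d2u [Hv cv] tr] xc Fc].
case=> -[un vn] [/= [[dun cun] d2un [Hvn cvn] trn] xnc Fnc] F1 xM.
set E := energy_norm (x - xn).
have zz0 := sqnormc_ge0 z.
set S := 8 * _ + _ + _.
have S0 : 0 <= S.
  apply: addr_ge0 => //; apply: addr_ge0; apply: mulr_ge0; rewrite ?sqr_ge0//.
  exact: mulr_ge0.
have E0 : 0 <= E by exact: energy_norm_ge0.
have T0 : 0 <= (2 + 8 * sqnormc z) * E.
  by apply: mulr_ge0 => //; apply: addr_ge0 => //; exact: mulr_ge0.
pose w : starfun R N := -1 *: un + u; pose y : starfun R N := -1 *: vn + v.
have Dc := energy_class_lin (-1) xnc xc.
have E2 := energy_normE Dc.
rewrite (_ : -1 *: xn + x = x - xn) -/E in E2; last by rewrite scaleN1r addrC.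
(* F is represented by (- z u + v, - z v + u'') and also by the damped counterpart; comparing the
   two yields the equations for w and y. *)
have FA := energy_class_lin (- z) xc Fc.
rewrite (_ : - z *: x + (F + z *: x) = F) in FA; last by rewrite scaleNr addrC addrK.
have FB := energy_class_lin (- z) xnc Fnc.
rewrite (_ : - z *: xn + (F + z *: xn) = F) in FB; last by rewrite scaleNr addrC addrK.
have EF := energy_normE FA.
have Ex := energy_normE xc.
have [c Hc] := tildeH1_class_eq FA.1 FB.1.
have Hl := L2_class_eq FA.2 FB.2.
(* For v the chosen [vertex_value] is required, as it occurs in the domain of [wave]; for vn any
   common trace serves. *)
pose nu := vertex_value v.
have nuP := vertex_valueP cv.
have [en enP] := cvn.
pose e := -1 * en + nu; pose nn := -1 * nu + 0.
pose a0 j := -1 * trace (Defs.deriv 1 un j) + trace (Defs.deriv 1 u j).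
have sumC (f g : 'I_N -> R -> R[i]) (B : R) j :
    B = \sum_i csqn (f i) + \sum_i csqn (g i) -> csqn (f j) <= B /\ csqn (g j) <= B.
  move=> ->; split; apply: (le_trans (le_sum_csqn _ j)).
    by rewrite lerDl; apply: sumr_ge0 => i _; exact: csqn_ge0.
  by rewrite lerDr; apply: sumr_ge0 => i _; exact: csqn_ge0.
have M2 : energy_norm x ^+ 2 <= M ^+ 2.
  by rewrite ler_pXn2r ?nnegrE ?energy_norm_ge0// (le_trans (energy_norm_ge0 x)).
have F2 : energy_norm F ^+ 2 <= 1 by rewrite exprn_ile1// energy_norm_ge0.
have edge j : - (s * complex.Re z) * (csqn (Defs.deriv 1 w j) + csqn (y j)) <=
  s * (complex.Re (a0 j) * complex.Re e + complex.Im (a0 j) * complex.Im e)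
  - s * re_dot (complex.Re alpha) (complex.Im alpha)
      (complex.Re nn) (complex.Im nn) (complex.Re e) (complex.Im e)
    * \int[mu]_(u in hl) r j u
  + 4 * (`|complex.Re alpha| + `|complex.Im alpha|) * S * ((2 + 8 * sqnormc z) * E)
    * \int[mu]_(u in hl) (Num.sqrt u * r j u).
  have dw : dotH 1 (w j) by exact: (dotH_lin (-1) (dun j) (du j)).
  have d2w : dotH 2 (w j) by exact: (dotH_lin (-1) (d2un j) (d2u j)).
  have [Lv dv] := Hv j; have [Lvn dvn] := Hvn j.
  have dy : dotH 1 (y j) by exact: (dotH_lin (-1) dvn dv).
  have [wa La] := weak_derivP dw; have [wb Lb] := weak_derivP d2w.
  have [yp Lp] := weak_derivP dy; have [vv' Lv'] := weak_derivP dv.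
  have [uu' Lu'] := weak_derivP (du j); have [uu2 Lu2] := weak_derivP (d2u j).
  have [uun' Lun'] := weak_derivP (dun j); have [uun2 Lun2] := weak_derivP (d2un j).
  have Ly : is_L2 (y j) by exact: (is_L2_lin (-1) Lvn Lv).
  have ab := weak_deriv12 dw d2w.
  have ta : has_trace (Defs.deriv 1 w j) (a0 j).
    apply: (has_trace_ae (weak_deriv_linE (-1) (dun j) (du j))).
    apply: has_trace_lin.
      exact: (traceP (weak_deriv12 (dun j) (d2un j)) Lun2).
    exact: (traceP (weak_deriv12 (du j) (d2u j)) Lu2).
  have ty : has_trace (y j) e by exact: (has_trace_lin (-1) (enP j) (nuP j)).
  (* the edge estimate is applied with - v because the difference is v - v_n *)
  pose V t := -1 * v j t + 0; pose q t := -1 * weak_deriv 1 (v j) t + 0.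
  have L0 := is_L2_0 R.
  have VV' : is_weak_deriv 1 V q := is_weak_deriv_lin (-1) vv' (is_weak_deriv_0 R 1).
  have LV : is_L2 V := is_L2_lin (-1) Lv L0.
  have Lq : is_L2 q := is_L2_lin (-1) Lv' L0.
  have tV : has_trace V nn := has_trace_lin (-1) (nuP j) (has_trace_0 R).
  (* The first components of F agree up to c, so y = z w + c and derivation removes c. *)
  have Hp0 : ae_eqF (weak_deriv 1 (y j)) (fun t => z * weak_deriv 1 (w j) t + 0).
    apply: (weak_deriv_eq_const (c := c) yp (is_weak_deriv_lin z wa (is_weak_deriv_0 R 1))).
    apply: filterS (Hc j) => t Ht Dt.
    have {Ht}Ht : - z * u j t + v j t = - z * un j t + vn j t + c := Ht Dt.
    have -> : y j t = -1 * vn j t + v j t by [].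
    have -> : w j t = -1 * un j t + u j t by [].
    have -> : v j t = - z * un j t + vn j t + c + z * u j t by rewrite -Ht; ring.
    by ring.
  have Hp : ae_eqF (weak_deriv 1 (y j)) (fun t => z * weak_deriv 1 (w j) t).
    by apply: filterS Hp0 => t Ht Dt; rewrite Ht// addr0.
  (* The damping term carries v_n, and - v_n = y + V. *)
  have Hb : ae_eqF (weak_deriv 2 (w j))
      (fun t => z * y j t - alpha * (r j t)%:C%C * (y j t + V t)).
    apply: filterS2 (weak_deriv_linE (-1) (d2un j) (d2u j)) (Hl j) => t H1 Ht Dt.
    have {}H1 : weak_deriv 2 (w j) t =
      -1 * weak_deriv 2 (un j) t + weak_deriv 2 (u j) t := H1 Dt.
    have {Ht}Ht : - z * v j t + weak_deriv 2 (u j) t = - z * vn j t +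
      (weak_deriv 2 (un j) t + alpha * (r j t)%:C%C * vn j t) := Ht Dt.
    rewrite H1 /V.
    have -> : y j t = -1 * vn j t + v j t by [].
    have -> : weak_deriv 2 (u j) t = - z * vn j t +
      (weak_deriv 2 (un j) t + alpha * (r j t)%:C%C * vn j t) + z * v j t by rewrite -Ht; ring.
    by ring.
  have [df Lf] := weak_derivP (dotH_lin (- z) (du j) dv).
  set f' := weak_deriv 1 _ in df Lf.
  have Hv' : ae_eqF (weak_deriv 1 (v j)) (fun t => z * weak_deriv 1 (u j) t + f' t).
    apply: filterS (weak_deriv_linE (- z) (du j) dv) => t Ht Dt.
    by rewrite /f' (Ht Dt); ring.
  have [cf _] := sumC _ _ _ j EF; have [cu' cv'] := sumC _ _ _ j Ex.
  have [ca cy] := sumC _ _ _ j E2.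
  have BV := csqn_lin_le (-1) Lv L0; have Bq := csqn_lin_le (-1) Lv' L0.
  have Bv := csqn_lin_le z Lu' Lf.
  rewrite -(csqn_ae Lv' (is_L2_lin z Lu' Lf) Hv') in Bv.
  rewrite csqn0 sqnormcN1 in BV; rewrite csqn0 sqnormcN1 in Bq.
  have Bp := csqn_lin_le z La L0.
  rewrite -(csqn_ae Lp (is_L2_lin z La L0) Hp0) csqn0 in Bp.
  have HS := data_bound_sqr zz0 (sqr_ge0 M) BV Bq Bv (le_trans cv' M2)
    (le_trans cu' M2) (le_trans cf F2).
  have HT := difference_bound_sqr zz0 erefl Bp ca cy.
  exact: (edge_estimate_complex s1 sal S0 T0 ab La Lb ta yp Ly Lp ty VV' LV Lq tV
    Hp Hb (Ir j) (Isr j) (r0 j) HS HT).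
(* The vertex conditions give 0 for u_n and - alpha v(0) for u, while [nn] is - v(0). *)
have sum_a0 : \sum_j a0 j = alpha * nn.
  rewrite /a0 big_split/= -mulr_sumr trn mulr0 add0r /nn addr0.
  by move/eqP: tr; rewrite addr_eq0 => /eqP ->; rewrite /nu; ring.
have := ler_sum (index_enum 'I_N) (fun j (_ : true) => edge j).
rewrite -mulr_sumr big_split/= -E2.
rewrite big_split/= sumrB -!mulr_sumr r1 rm big_split/= -!mulr_suml -Re_sum -Im_sum sum_a0.
by rewrite Re_mul_conj mulr1 subrr add0r.
Qed.

End Difference.

(** * From the energy estimate to convergence in operator norm *)

Section Convergence.
Variable R : realType.
Local Notation mu := (@lebesgue_measure R).
Local Notation hl := (@halfline R).

(** The chosen representative of the zero class need not be the zero function, hence the detour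
    through [energy_normE]. *)
Lemma energy_norm0 N : energy_norm (0 : energy R N) = 0.
Proof.
have c0 : energy_class (0 : energy R N) (0, 0).
  split; [exists (0 : dotH1fun R N)|exists (0 : L2fun R N)];
    by rewrite ?raddf0.
have := energy_normE c0; rewrite [X in _ = X + _]big1; last first.
  move=> j _; have [D L] := weak_derivP (dotH_0 R 1).
  rewrite -(@csqn0 R); apply: csqn_ae => //; first exact: is_L2_0.
  by apply: (weak_deriv_const D); apply: aeW.
rewrite big1 => [|j _]; last exact: csqn0.
by rewrite addr0 => /eqP; rewrite sqrf_eq0 => /eqP.
Qed.

(** The unit ball contains 0, so the supremum is not the -oo of an empty set. *)
Lemma opnorm_ge0 N (A : energy R N -> energy R N) : (0 <= opnorm A)%E.
Proof.
apply: (@le_trans _ _ (energy_norm (A 0))%:E).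
  by rewrite lee_fin energy_norm_ge0.
by apply: ereal_sup_ubound; exists 0 => //=; rewrite energy_norm0.
Qed.

Lemma resolventP N (W : set (energy R N * energy R N)) z :
  resolvent_set W z -> is_resolvent W z (resolvent W z).
Proof.
move=> [T HT].
exact: (@xgetPex _ (fun=> 0) [set T | is_resolvent W z T] (ex_intro _ T HT)).
Qed.

Lemma le_of_quadratic_le (c K E : R) : 0 < c -> 0 <= E -> 0 <= K ->
  c * E ^+ 2 <= K * E -> E <= K / c.
Proof.
move=> c0; rewrite le_eqVlt => /predU1P[<- K0 _|E0 K0].
  by rewrite divr_ge0// ltW.
by rewrite expr2 mulrA ler_pM2r// mulrC -ler_pdivlMr.
Qed.

Lemma cvg_sqrt_inv : Num.sqrt (n%:R^-1) @[n --> \oo] --> (0 : R).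
Proof.
rewrite -(cvg_shiftS (fun n => Num.sqrt (n%:R^-1 : R))).
have H : Num.sqrt (n.+1%:R^-1) @[n --> \oo] --> Num.sqrt (0 : R).
  apply: (@cvg_comp _ _ _ (fun n => n.+1%:R^-1 : R) Num.sqrt _ (nbhs (0:R))).
    exact: cvg_harmonic.
  exact: sqrt_continuous.
by rewrite sqrtr0 in H.
Qed.

End Convergence.

Unset Implicit Arguments.
Set Strict Implicit.

Theorem theorem2p2 (R : realType) (N : nat) (rho : 'I_N -> R -> R)
    (s : bool) (alpha z : R[i])
    (N_gt0 : (0 < N)%N)
    (rho_L1 : forall j,
       (@lebesgue_measure R).-integrable (@halfline R) (EFin \o rho j))
    (rho_ge0 : forall j,
       {ae @lebesgue_measure R, forall x, halfline x -> 0 <= rho j x})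
    (rho_moment : forall j,
       (\int[@lebesgue_measure R]_(x in @halfline R)
          (Num.sqrt x * rho j x)%:E < +oo)%E)
    (rho_mass :
       (\sum_(j < N)
          \int[@lebesgue_measure R]_(x in @halfline R) (rho j x)%:E = 1)%E)
    (alpha_half : closed_half_plane s alpha)
    (z_half : half_plane (~~ s) z)
    (z_wave : resolvent_set (wave N alpha) z)
    (z_damped : forall n, (0 < n)%N ->
       resolvent_set (damped_wave alpha rho n) z) :
  opnorm (resolvent (wave N alpha) z - resolvent (damped_wave alpha rho n) z)
    @[n --> \oo] --> 0%E.
Proof.
set mu := (@lebesgue_measure R).
pose sg : R := (-1) ^+ s.
have sg1 : `|sg| = 1 by rewrite normrX normrN1 expr1n.
have sal : 0 <= sg * complex.Re alpha by exact: alpha_half.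
(* Negating s flips the sign, so z in the opposite open half-plane means - sg Re z > 0. *)
have c0 : 0 < - (sg * complex.Re z).
  move: z_half; rewrite /half_plane/= /sg.
  by case: s {sg sg1 sal alpha_half}; rewrite /= ?expr0 ?expr1 !mul1r ?mulN1r ?opprK.
have mr j : measurable_fun (@halfline R) (rho j).
  by apply/measurable_EFinP; exact: measurable_int (rho_L1 j).
have Is j := sqrt_integrable (rho_ge0 j) (mr j) (rho_moment j).
pose m := \sum_j \int[mu]_(x in @halfline R) (Num.sqrt x * rho j x).
have m0 : 0 <= m.
  apply: sumr_ge0 => j _.
  have := @ae_le_Rintegral R (fun=> 0) _ (integrable0 _ _) (Is j).
  rewrite Rintegral_cst// mul0r.
  apply; by apply: filterS (rho_ge0 j) => x H Dx; rewrite mulr_ge0 ?sqrtr_ge0 ?H.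
have mass : \sum_j \int[mu]_(x in @halfline R) rho j x = 1.
  have E j : (\int[mu]_(x in @halfline R) (rho j x)%:E =
      (\int[mu]_(x in @halfline R) rho j x)%:E)%E.
    by rewrite fineK//; apply: integrable_fin_num => //; exact: (rho_L1 j).
  by move: rho_mass; rewrite (eq_bigr _ (fun j _ => E j)) sumEFin => -[].
have [[linT [M HM]] T1 _] := resolventP z_wave.
set T := resolvent (wave N alpha) z in linT HM T1 *.
(* The constants of [energy_difference_le] without E and the moment; |M| replaces M because an
   operator bound comes with no sign. *)
pose c1 := 4 * (`|complex.Re alpha| + `|complex.Im alpha|) *
    (8 * `|M| ^+ 2 + 32 * sqnormc z * `|M| ^+ 2 + 16) * (2 + 8 * sqnormc z).
have zz0 := sqnormc_ge0 z.
have c10 : 0 <= c1.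
  have h1 : 0 <= 8 * `|M| ^+ 2 by apply: mulr_ge0 => //; exact: sqr_ge0.
  have h2 : 0 <= 32 * sqnormc z * `|M| ^+ 2.
    by apply: mulr_ge0; [exact: mulr_ge0|exact: sqr_ge0].
  have h3 : 0 <= 8 * sqnormc z by exact: mulr_ge0.
  apply: mulr_ge0; last exact: addr_ge0.
  apply: mulr_ge0; last by apply: addr_ge0 => //; exact: addr_ge0.
  by apply: mulr_ge0 => //; exact: addr_ge0.
pose C := c1 * m / (- (sg * complex.Re z)).
have bound n : (0 < n)%N ->
    (opnorm (T - resolvent (damped_wave alpha rho n) z)%R <= (C * Num.sqrt (n%:R^-1))%:E)%E.
  move=> n0; have k0 : (0 : R) < n%:R by rewrite ltr0n.
  have [_ Tn1 _] := resolventP (z_damped n n0).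
  set Tn := resolvent (damped_wave alpha rho n) z in Tn1 *.
  apply: ge_ereal_sup => _ [F /= F1 <-]; rewrite lee_fin.
  have xM : energy_norm (T F) <= `|M|.
    apply: (le_trans (HM F)); apply: (@le_trans _ _ (`|M| * energy_norm F)).
      by rewrite ler_wpM2r ?energy_norm_ge0 ?ler_norm.
    by rewrite ler_piMr.
  have I1 j := scaled_integral k0 (rho_ge0 j) (rho_L1 j).
  have I2 j := scaled_sqrt_integral k0 (rho_ge0 j) (Is j).
  have mass' : \sum_j \int[mu]_(x in @halfline R) rescale rho n j x = 1.
    by rewrite -mass; apply: eq_bigr => j _; have [] := I1 j.
  have mom : \sum_j \int[mu]_(x in @halfline R) (Num.sqrt x * rescale rho n j x) =
      Num.sqrt n%:R^-1 * m.
    by rewrite /m mulr_sumr; apply: eq_bigr => j _; have [] := I2 j.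
  have H := @energy_difference_le R N (rescale rho n) sg `|M| _ alpha z (T F) (Tn F) F sg1 sal
    (fun j => (I1 j).1) (fun j => (I2 j).1) (fun j => rescale_ae_ge0 k0 (rho_ge0 j))
    mass' mom (T1 F) (Tn1 F) F1 xM.
  set E := energy_norm (T F - Tn F) in H.
  have E0 : 0 <= E by exact: sqrtr_ge0.
  have -> : energy_norm ((T - Tn) F) = E by [].
  have K0 : 0 <= c1 * (Num.sqrt n%:R^-1 * m).
    by apply: mulr_ge0 => //; apply: mulr_ge0 => //; exact: sqrtr_ge0.
  have H' : - (sg * complex.Re z) * E ^+ 2 <= c1 * (Num.sqrt n%:R^-1 * m) * E.
    by apply: (le_trans H); rewrite /c1 le_eqVlt; apply/orP; left; apply/eqP; ring.
  apply: (le_trans (le_of_quadratic_le c0 E0 K0 H')).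
  by rewrite /C le_eqVlt; apply/orP; left; apply/eqP; ring.
have lim0 : (C * Num.sqrt (n%:R^-1))%:E @[n --> \oo] --> (0 : R)%:E.
  apply: cvg_EFin; first exact: nearW.
  rewrite /comp/= -[X in _ --> X](mulr0 C); apply: cvgM; first exact: cvg_cst.
  exact: cvg_sqrt_inv.
apply: (squeeze_cvge _ (cvg_cst 0%E) lim0).
(* The bound starts at n = 1, like the hypothesis on the damped resolvents. *)
exists 1%N => // n /= n0; rewrite opnorm_ge0/=; exact: bound.
Qed.
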